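(* Let $W_{\mathbf{L},\mathbf{K}}$ be generic and suppose that either $k_a+2\,l_a>0$ for all $a=1,\ldots,r$, or $k_a+2\,l_a<0$ for all $a=1,\ldots,r$ (equivalently, $\mathbf{0}\not\in\Phi_{\mathbf{L},\mathbf{K}}(\mathbb{P}(W_{\mathbf{L},\mathbf{K}}))$; equivalently, $\mathbf{0}\not\in\Psi_{\mathbf{L},\mathbf{K}}(\mathbb{P}(W_{\mathbf{L},\mathbf{K}}))$). Let $\boldsymbol{\nu}=(\nu_1,\nu_2)^t\in\mathbb{R}^2$ with $\nu_1\neq\nu_2$. Then the following conditions are equivalent: (1) $\Phi_{\mathbf{L},\mathbf{K}}$ is not transverse to $\mathcal{C}(\mathcal{O}_{\boldsymbol{\nu}})$; (2) $\Psi_{\mathbf{L},\mathbf{K}}$ is not transverse to $\mathbb{R}_+\,\imath\,\boldsymbol{\nu}$; (3) there exist $a\in\{1,\ldots,r\}$ and $j\in\{0,\ldots,k_a\}$ such that $\boldsymbol{\nu}\in\mathbb{R}_+\cdot\boldsymbol{\nu}_{k_a,j,l_a}$.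
   Context: $G=U(2)$, $\mathfrak{g}=\mathfrak{u}(2)$ is the space of $2\times 2$ skew-Hermitian matrices, $T\le G$ the torus of diagonal matrices, and $\mathfrak{t}\subset\mathfrak{g}$ the diagonal skew-Hermitian matrices, identified with $\imath\,\mathbb{R}^2$ by taking diagonal entries. $\mathbb{R}_+$ is the set of positive reals. A smooth map $f:M\to V$ to a vector space is transverse to a submanifold $R\subset V$ if $\mathrm{d}_mf(T_mM)+T_{f(m)}R=V$ whenever $f(m)\in R$. For $\boldsymbol{\nu}\in\mathbb{R}^2$, $\mathcal{O}_{\boldsymbol{\nu}}\subset\mathfrak{g}$ is the orbit under conjugation by $G$ of $\imath\,\mathrm{diag}(\nu_1,\nu_2)$, and $\mathcal{C}(\mathcal{O}_{\boldsymbol{\nu}})=\mathbb{R}_+\cdot\mathcal{O}_{\boldsymbol{\nu}}$. For $k\ge 0$ write points of $\mathbb{C}^{k+1}$ as $Z=(z_0,\ldots,z_k)^t$ and set $F_{k,1}(Z):=\left(\sqrt{k-j+1}\,z_{j-1}\right)_{j=1}^k$, $F_{k,2}(Z):=\left(\sqrt{j}\,z_j\right)_{j=1}^k$ in $\mathbb{C}^k$ (these are $0$ if $k=0$). Let $r\ge 1$, $\mathbf{L}=(l_a)\in\mathbb{Z}^r$, $\mathbf{K}=(k_a)\in\mathbb{N}^r$, and $W_{\mathbf{L},\mathbf{K}}=\bigoplus_{a=1}^r\det^{\otimes l_a}\otimes\mathrm{Sym}^{k_a}(\mathbb{C}^2)\cong\bigoplus_{a=1}^r\mathbb{C}^{k_a+1}$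 (composed with the automorphism $B\mapsto(B^t)^{-1}$ of $G$). Write $Z=(Z_a)_{a=1}^r$ with $Z_a\in\mathbb{C}^{k_a+1}$. The moment map (with respect to twice the Fubini-Study form) of the $G$-action on $\mathbb{P}(W_{\mathbf{L},\mathbf{K}})$ is $\Phi_{\mathbf{L},\mathbf{K}}:\mathbb{P}(W_{\mathbf{L},\mathbf{K}})\to\mathfrak{g}$, $$\Phi_{\mathbf{L},\mathbf{K}}([Z])=\frac{\imath}{\|Z\|^2}\sum_{a=1}^r\begin{pmatrix}\|F_{k_a,1}(Z_a)\|^2+l_a\|Z_a\|^2& F_{k_a,2}(Z_a)^t\,\overline{F_{k_a,1}(Z_a)}\\ F_{k_a,1}(Z_a)^t\,\overline{F_{k_a,2}(Z_a)}&\|F_{k_a,2}(Z_a)\|^2+l_a\|Z_a\|^2\end{pmatrix},$$ and the moment map $\Psi_{\mathbf{L},\mathbf{K}}:\mathbb{P}(W_{\mathbf{L},\mathbf{K}})\to\mathfrak{t}$ of the $T$-action is the diagonal part of $\Phi_{\mathbf{L},\mathbf{K}}$. $W_{\mathbf{L},\mathbf{K}}$ is generic if, whenever for some $l\in\mathbb{Z}$ the pair $(l,1)$ appears in the sequence $(l_1,k_1),\ldots,(l_r,k_r)$, there are $1\le a<b\le r$ with $(l_a,k_a)=(l_b,k_b)=(l,1)$. For $a=1,\ldots,r$ and $j=0,\ldots,k_a$, $\boldsymbol{\nu}_{k_a,j,l_a}:=\begin{pmatrix}k_a-j+l_a&j+l_a\end{pmatrix}^t$. *)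

(* Defs.v *)
From mathcomp Require Import all_boot all_order all_algebra.
From mathcomp Require Import all_classical all_reals all_analysis.
From mathcomp Require Import complex.

Set Implicit Arguments.
Unset Strict Implicit.
Unset Printing Implicit Defensive.

Import Order.TTheory GRing.Theory Num.Theory.
Import numFieldNormedType.Exports.

Local Open Scope classical_set_scope.
Local Open Scope ring_scope.
Local Open Scope complex_scope.
Local Open Scope sesquilinear_scope.

(* Throughout, C is R[i] for R : realType, and real vector spaces of complex  *)
(* matrices are given as subsets of 'M[R[i]]_n.                               *)

Section ProjectiveSpace.
Variables (R : realType) (n : nat).

Definition cline (Z : 'cV[R[i]]_n) : set 'cV[R[i]]_n :=
  [set W | exists c : R[i], W = c *: Z].

Record proj := Proj {
  line_of : set 'cV[R[i]]_n;
  line_ofP : exists2 Z : 'cV[R[i]]_n, Z != 0 & line_of = cline Z }.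

Definition proj_class (Z : 'cV[R[i]]_n) (Z_neq0 : Z != 0) : proj :=
  Proj (ex_intro2 _ _ Z Z_neq0 erefl).

Definition proj_repr (m : proj) : 'cV[R[i]]_n := sval (cid2 (line_ofP m)).

Lemma proj_repr_neq0 (m : proj) : proj_repr m != 0.
Proof. by rewrite /proj_repr; case: cid2. Qed.

Lemma proj_repr_line (m : proj) : line_of m = cline (proj_repr m).
Proof. by rewrite /proj_repr; case: cid2. Qed.

(* The affine chart of P^(n-1) around the points with nonzero i-th            *)
(* homogeneous coordinate: w |-> [w with a 1 inserted at position i].         *)
Definition affine_pt (i : 'I_n) (w : 'cV[R[i]]_n.-1) : 'cV[R[i]]_n :=
  \col_k oapp (fun j => w j 0) 1 (unlift i k).

Lemma affine_pt_neq0 (i : 'I_n) (w : 'cV[R[i]]_n.-1) : affine_pt i w != 0.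
Proof.
by apply/eqP => /colP/(_ i)/eqP; rewrite !mxE unlift_none /= oner_eq0.
Qed.

Definition chart (i : 'I_n) (w : 'cV[R[i]]_n.-1) : proj :=
  proj_class (affine_pt_neq0 i w).

End ProjectiveSpace.

Section Transversality.
Variable R : realType.

(* The derivative at 0 of a curve in the real vector space 'M[R[i]]_p,        *)
(* taken on the real and imaginary parts of the entries.                      *)
Definition velocity (p : nat) (gamma : R -> 'M[R[i]]_p) (X : 'M[R[i]]_p) :=
  forall i j, is_derive (0 : R) 1 (fun t => complex.Re (gamma t i j))
                        (complex.Re (X i j)) /\
              is_derive (0 : R) 1 (fun t => complex.Im (gamma t i j))
                        (complex.Im (X i j)).

(* Velocities of differentiable curves in S through x; this is the tangent    *)
(* space T_x S when S is an embedded submanifold.                             *)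
Definition tangent (p : nat) (S : set 'M[R[i]]_p) (x : 'M[R[i]]_p) :
    set 'M[R[i]]_p :=
  [set X | exists gamma : R -> 'M[R[i]]_p,
    [/\ gamma 0 = x, \forall t \near (0 : R), S (gamma t)
      & velocity gamma X]].

(* The image of d_m f for f a smooth map on a projective space: the real      *)
(* directional derivatives of f read in the affine charts around m.           *)
Definition diff_image (n p : nat) (f : proj R n -> 'M[R[i]]_p) (m : proj R n) :
    set 'M[R[i]]_p :=
  [set X | exists (i : 'I_n) (w v : 'cV[R[i]]_n.-1),
    chart i w = m /\ velocity (fun t : R => f (chart i (w + t%:C *: v))) X].

Definition transverse (n p : nat) (V : set 'M[R[i]]_p)
    (f : proj R n -> 'M[R[i]]_p) (S : set 'M[R[i]]_p) :=
  forall m, S (f m) ->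
    [set X + Y | X in diff_image f m & Y in tangent S (f m)] = V.

End Transversality.

Section UnitaryGroup.
Variable R : realType.

Definition u2 : set 'M[R[i]]_2 := [set A | A ^t* = - A].

(* t is kept inside u(2) as diagonal matrices instead of i R^2. *)
Definition t2 : set 'M[R[i]]_2 := [set A | u2 A /\ is_diag_mx A].

Definition idiag (nu : 'cV[R]_2) : 'M[R[i]]_2 :=
  'i%C *: diag_mx (\row_j (nu j 0)%:C).

Definition coadj_orbit (nu : 'cV[R]_2) : set 'M[R[i]]_2 :=
  [set A | exists2 g : 'M[R[i]]_2,
    g \is unitarymx & A = g *m idiag nu *m invmx g].

Definition cone (p : nat) (S : set 'M[R[i]]_p) : set 'M[R[i]]_p :=
  [set A | exists2 c : R, 0 < c & exists2 X, S X & A = c%:C *: X].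

End UnitaryGroup.

Arguments u2 : clear implicits.
Arguments t2 : clear implicits.

Section MomentMap.
Variable R : realType.

Definition sqnorm (n : nat) (v : 'cV[R[i]]_n) : R[i] :=
  \sum_i `|v i 0| ^+ 2.

(* Z j 0 is z_j; the rows of F1 and F2, usually numbered 1, ..., k, are       *)
(* numbered 0, ..., k-1.                                                      *)
Definition F1 (k : nat) (Z : 'cV[R[i]]_k.+1) : 'cV[R[i]]_k :=
  \col_(j < k) ((Num.sqrt (k - j)%:R)%:C * Z (widen_ord (leqnSn k) j) 0).

Definition F2 (k : nat) (Z : 'cV[R[i]]_k.+1) : 'cV[R[i]]_k :=
  \col_(j < k) ((Num.sqrt j.+1%:R)%:C * Z (lift ord0 j) 0).

Definition dotT (n : nat) (u v : 'cV[R[i]]_n) : R[i] :=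
  (u^T *m map_mx Num.conj v) 0 0.

Definition mx22 (a b c d : R[i]) : 'M[R[i]]_2 :=
  \matrix_(i, j) if i == 0 then (if j == 0 then a else b)
                 else (if j == 0 then c else d).

Definition moment_block (l : int) (k : nat) (Z : 'cV[R[i]]_k.+1) :
    'M[R[i]]_2 :=
  mx22 (sqnorm (F1 Z) + l%:~R * sqnorm Z) (dotT (F2 Z) (F1 Z))
       (dotT (F1 Z) (F2 Z)) (sqnorm (F2 Z) + l%:~R * sqnorm Z).

Variables (r : nat) (L : 'I_r -> int) (K : 'I_r -> nat).

(* W_{L,K} is 'cV_(\sum_a (K a).+1), with Z_a the block submxcol Z a. *)
Definition moment_formula (Z : 'cV[R[i]]_(\sum_(a < r) (K a).+1)) :
    'M[R[i]]_2 :=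
  ('i%C / sqnorm Z) *: \sum_(a < r) moment_block (L a) (submxcol Z a).

Lemma sqnormZ n (c : R[i]) (v : 'cV[R[i]]_n) :
  sqnorm (c *: v) = `|c| ^+ 2 * sqnorm v.
Proof.
by rewrite /sqnorm big_distrr; apply: eq_bigr => i _; rewrite mxE normrM exprMn.
Qed.

Lemma F1Z k (c : R[i]) (Z : 'cV[R[i]]_k.+1) : F1 (c *: Z) = c *: F1 Z.
Proof. by apply/colP => j; rewrite !mxE mulrCA. Qed.

Lemma F2Z k (c : R[i]) (Z : 'cV[R[i]]_k.+1) : F2 (c *: Z) = c *: F2 Z.
Proof. by apply/colP => j; rewrite !mxE mulrCA. Qed.

Lemma dotTZ n (c : R[i]) (u v : 'cV[R[i]]_n) :
  dotT (c *: u) (c *: v) = `|c| ^+ 2 * dotT u v.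
Proof.
rewrite /dotT !mxE big_distrr; apply: eq_bigr => i _.
by rewrite !mxE rmorphM normCK mulrACA.
Qed.

Lemma moment_blockZ l k (c : R[i]) (Z : 'cV[R[i]]_k.+1) :
  moment_block l (c *: Z) = `|c| ^+ 2 *: moment_block l Z.
Proof.
rewrite /moment_block F1Z F2Z !dotTZ !sqnormZ.
by apply/matrixP => i j; rewrite !mxE !(mulrCA l%:~R) -!mulrDr !(fun_if ( *%R _)).
Qed.

Lemma moment_formulaZ (c : R[i]) Z :
  c != 0 -> moment_formula (c *: Z) = moment_formula Z.
Proof.
move=> c_neq0; rewrite /moment_formula sqnormZ.
have c2_neq0 : `|c| ^+ 2 != 0 by rewrite expf_neq0 // normr_eq0.
rewrite (eq_bigr (fun a => `|c| ^+ 2 *: moment_block (L a) (submxcol Z a)));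
  last first.
  move=> a _; rewrite -moment_blockZ; congr moment_block.
  by apply/matrixP => i j; rewrite !mxE.
rewrite -scaler_sumr; move: (`|c| ^+ 2) c2_neq0 => d d_neq0.
by rewrite scalerA invfM -mulrA (mulrAC d^-1) mulVf ?mul1r.
Qed.

Definition Phi (m : proj R (\sum_(a < r) (K a).+1)) : 'M[R[i]]_2 :=
  moment_formula (proj_repr m).

Lemma Phi_class Z (Z_neq0 : Z != 0) : Phi (proj_class Z_neq0) = moment_formula Z.
Proof.
have := proj_repr_line (proj_class Z_neq0).
move/(congr1 (fun S : set _ => S (proj_repr (proj_class Z_neq0)))) => /= E.
have [c cE] : cline Z (proj_repr (proj_class Z_neq0)).
  by rewrite E; exists 1; rewrite scale1r.
rewrite /Phi cE moment_formulaZ //.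
apply: contra_neq (proj_repr_neq0 (proj_class Z_neq0)).
by move=> c0; rewrite cE c0 scale0r.
Qed.

Definition Psi (m : proj R (\sum_(a < r) (K a).+1)) : 'M[R[i]]_2 :=
  diag_mx (\row_j Phi m j j).

Definition generic :=
  forall l : int, (exists a, (L a, K a) = (l, 1%N)) ->
    exists a b : 'I_r,
      [/\ (a < b)%N, (L a, K a) = (l, 1%N) & (L b, K b) = (l, 1%N)].

Definition definite :=
  (forall a, 0 < (K a)%:Z + 2 * L a) \/ (forall a, (K a)%:Z + 2 * L a < 0).

Definition nu_weight (k j : nat) (l : int) : 'cV[R]_2 :=
  \col_i (if i == 0 then k%:Z - j%:Z + l else j%:Z + l)%:~R.

End MomentMap.

(* Main.v *)
(**
Write [<Z, W>] for the sesquilinear form with values in gl(2) whose values at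
[Z = W] give the moment map up to the factor [i / |Z|^2].  Suppose that a
Hermitian matrix [xi] annihilates both [Phi [Z]] and the image of the
differential at [[Z]].  Then [tr (<Z, W> xi) = 0] for all [W], that is, [Z] is
in the kernel of the operator by which [xi] acts on [W_{L,K}].  On
[det^l (x) Sym^k] this operator is a first order differential operator
[Q p' + lin p] on polynomials of degree at most [k]; the multiplicity [j] at a
root of [Q] of a polynomial in its kernel satisfies
[(k - j + l) al + (j + l) (tr xi - al) = 0] for an eigenvalue [al] of [xi].

Transversality fails at [[Z]] only if such a [xi] is also orthogonal to the
tangent space of the cone.  For the ray of [i nu] this forces
[xi = diag (nu_2, - nu_1)], for the cone over the orbit through [A = Phi [Z]] it
forces [xi = tr A A - tr (A^2)], both up to a factor.  In both cases the
eigenvalues of [xi] are proportional to [nu_2, - nu_1], so [nu] is proportional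
to a weight, and the sign of [tr (Phi [Z])] makes the factor positive.
Conversely, transversality fails at the weight vectors.
*)

Require Import Defs.
From mathcomp Require Import all_boot all_order all_algebra.
From mathcomp Require Import all_classical all_reals all_analysis complex.
From mathcomp Require Import ring lra.

Set Implicit Arguments.
Unset Strict Implicit.
Unset Printing Implicit Defensive.

Import Order.TTheory GRing.Theory Num.Theory.
Import numFieldNormedType.Exports.

Local Open Scope classical_set_scope.
Local Open Scope ring_scope.
Local Open Scope complex_scope.
Local Open Scope sesquilinear_scope.

(** * Derivatives of complex valued curves *)

Section ComplexDerivative.
Variable R : realType.
Implicit Types (f g : R -> R[i]) (a b : R[i]).

(** The condition that [velocity] imposes on each entry, so [velocityP] holds by conversion and
    calculus rules can be proved for scalar curves. *)
Definition cder f a :=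
  is_derive (0 : R) 1 (fun t => complex.Re (f t)) (complex.Re a) /\
  is_derive (0 : R) 1 (fun t => complex.Im (f t)) (complex.Im a).

Lemma cder_uniq f a b : cder f a -> cder f b -> a = b.
Proof.
move=> [fa1 fa2] [fb1 fb2]; apply/eqP; rewrite eq_complex.
by rewrite -(@derive_val _ _ _ _ _ _ _ fa1) -(@derive_val _ _ _ _ _ _ _ fa2)
  (@derive_val _ _ _ _ _ _ _ fb1) (@derive_val _ _ _ _ _ _ _ fb2) !eqxx.
Qed.

Lemma cder_near f g a : (\forall t \near (0 : R), f t = g t) ->
  cder f a -> cder g a.
Proof.
move=> fg [fa1 fa2]; split; [apply: near_eq_is_derive fa1|
  apply: near_eq_is_derive fa2]; by near=> t; rewrite (near fg t).
Unshelve. all: by end_near. Qed.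

Lemma cder_ext f g a : f =1 g -> cder f a -> cder g a.
Proof. by move=> fg; apply: cder_near; near=> t.
Unshelve. all: by end_near. Qed.

Lemma cder_cst a : cder (fun=> a) 0.
Proof. by split; apply: is_derive_cst. Qed.

Lemma cderD f g a b : cder f a -> cder g b -> cder (fun t => f t + g t) (a + b).
Proof.
move=> [fa1 fa2] [gb1 gb2]; split.
  have -> : (fun t => complex.Re (f t + g t)) =
    (fun t => complex.Re (f t)) + (fun t => complex.Re (g t)).
    by apply/funext => t /=; rewrite raddfD.
  by rewrite raddfD; apply: is_deriveD.
have -> : (fun t => complex.Im (f t + g t)) =
  (fun t => complex.Im (f t)) + (fun t => complex.Im (g t)).
  by apply/funext => t /=; rewrite raddfD.
by rewrite raddfD; apply: is_deriveD.
Qed.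

Lemma cderM f g a b : cder f a -> cder g b ->
  cder (fun t => f t * g t) (a * g 0 + f 0 * b).
Proof.
move=> [fa1 fa2] [gb1 gb2].
have ReD (x y : R[i]) : complex.Re (x + y) = complex.Re x + complex.Re y
  by case: x; case: y.
have ImD (x y : R[i]) : complex.Im (x + y) = complex.Im x + complex.Im y
  by case: x; case: y.
have ReM (x y : R[i]) : complex.Re (x * y) =
  complex.Re x * complex.Re y - complex.Im x * complex.Im y by case: x; case: y.
have ImM (x y : R[i]) : complex.Im (x * y) =
  complex.Re x * complex.Im y + complex.Im x * complex.Re y by case: x; case: y.
split.
  have -> : (fun t => complex.Re (f t * g t)) =
    (fun t => complex.Re (f t)) * (fun t => complex.Re (g t)) -
    (fun t => complex.Im (f t)) * (fun t => complex.Im (g t)).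
    by apply/funext => t /=; rewrite ReM.
  have d := is_deriveB (is_deriveM fa1 gb1) (is_deriveM fa2 gb2).
  apply: (is_derive_eq d).
  by rewrite ReD !ReM /GRing.scale /=; ring.
have -> : (fun t => complex.Im (f t * g t)) =
  (fun t => complex.Re (f t)) * (fun t => complex.Im (g t)) +
  (fun t => complex.Im (f t)) * (fun t => complex.Re (g t)).
  by apply/funext => t /=; rewrite ImM.
have d := is_deriveD (is_deriveM fa1 gb2) (is_deriveM fa2 gb1).
apply: (is_derive_eq d).
by rewrite ImD !ImM /GRing.scale /=; ring.
Qed.

Lemma cderMl a g b : cder g b -> cder (fun t => a * g t) (a * b).
Proof.
move=> gb; have := cderM (cder_cst a) gb.
by rewrite mul0r add0r.
Qed.

Lemma cderN f a : cder f a -> cder (fun t => - f t) (- a).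
Proof.
move=> /(cderMl (-1)); rewrite mulN1r; apply: cder_ext => t.
by rewrite mulN1r.
Qed.

Lemma cder_conj f a : cder f a -> cder (fun t => Num.conj (f t)) (Num.conj a).
Proof.
case: a => x y [/= fx fy]; split => /=.
  have -> : (fun t => complex.Re (Num.conj (f t))) = (fun t => complex.Re (f t)).
    by apply/funext => t; case: (f t).
  exact: fx.
have -> : (fun t => complex.Im (Num.conj (f t))) = - (fun t => complex.Im (f t)).
  have ImJ (z : R[i]) : complex.Im (Num.conj z) = - complex.Im z by case: z.
  by apply/funext => t; rewrite ImJ.
exact: is_deriveN.
Qed.

Lemma cder_real (f : R -> R) (a : R) :
  is_derive (0 : R) 1 f a -> cder (fun t => (f t)%:C) a%:C.
Proof. by move=> fa; split => //=; apply: is_derive_cst. Qed.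

Lemma cder_id : cder (fun t : R => t%:C) 1.
Proof. by apply: (@cder_real id); apply: is_derive_id. Qed.

(** The denominator of the moment map is a squared norm, hence real along any curve; an inverse rule
    for real curves is what the quotient rule requires. *)
Lemma cderV_real (f : R -> R) (a : R) : f 0 != 0 ->
  is_derive (0 : R) 1 f a ->
  cder (fun t => ((f t)%:C)^-1) (- a%:C / (f 0)%:C ^+ 2).
Proof.
move=> f0 fa; apply: (@cder_ext (fun t => ((f t)^-1)%:C)) => [t|].
  by rewrite fmorphV.
have := cder_real (is_deriveV f0 fa); congr cder.
by rewrite /GRing.scale /= rmorphM rmorphN fmorphV rmorphXn mulrC mulrN mulNr.
Qed.

(** Sesquilinear expressions restricted to a real line are quadratic in [t], and their derivative is
    the linear coefficient. *)
Lemma cder_poly2 a b (c : R[i]) :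
  cder (fun t : R => a + t%:C * b + (t ^+ 2)%:C * c) b.
Proof.
have := cderD (cderD (cder_cst a) (cderM cder_id (cder_cst b)))
  (cderM (cderM cder_id cder_id) (cder_cst c)).
rewrite !(mulr0, mul0r, addr0, add0r, mul1r) => h.
by apply: cder_ext h => t; rewrite rmorphXn expr2.
Qed.

Lemma velocityP p (gamma : R -> 'M[R[i]]_p) (X : 'M[R[i]]_p) :
  velocity gamma X <-> forall i j, cder (fun t => gamma t i j) (X i j).
Proof. by []. Qed.

Lemma velocity_uniq p (gamma : R -> 'M[R[i]]_p) X Y :
  velocity gamma X -> velocity gamma Y -> X = Y.
Proof.
by move=> gX gY; apply/matrixP => i j; apply: cder_uniq (gX i j) (gY i j).
Qed.

End ComplexDerivative.

(** * The moment map as a sesquilinear form *)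

Section MomentForm.
Variable R : realType.
Local Notation C := R[i].

(** Polarization of [moment_block], linear in [Z] and conjugate linear in [W]. *)
Definition block_form (l : int) (k : nat) (Z W : 'cV[C]_k.+1) : 'M[C]_2 :=
  mx22 (dotT (F1 Z) (F1 W) + l%:~R * dotT Z W) (dotT (F2 Z) (F1 W))
       (dotT (F1 Z) (F2 W)) (dotT (F2 Z) (F2 W) + l%:~R * dotT Z W).

Lemma dotTE n (u v : 'cV[C]_n) : dotT u v = \sum_i u i 0 * Num.conj (v i 0).
Proof. by rewrite /dotT mxE; apply: eq_bigr => i _; rewrite !mxE. Qed.

Lemma dotTDl n (u v w : 'cV[C]_n) : dotT (u + v) w = dotT u w + dotT v w.
Proof. by rewrite /dotT linearD mulmxDl mxE. Qed.

Lemma dotTZl n c (u v : 'cV[C]_n) : dotT (c *: u) v = c * dotT u v.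
Proof. by rewrite /dotT linearZ -scalemxAl mxE. Qed.

Lemma dotTC n (u v : 'cV[C]_n) : Num.conj (dotT u v) = dotT v u.
Proof.
rewrite !dotTE rmorph_sum; apply: eq_bigr => i _.
by rewrite rmorphM /= conjCK mulrC.
Qed.

Lemma sqnormE n (u : 'cV[C]_n) : sqnorm u = dotT u u.
Proof. by rewrite dotTE; apply: eq_bigr => i _; rewrite normCK. Qed.

Lemma sqnorm_ge0 n (u : 'cV[C]_n) : 0 <= sqnorm u.
Proof. by apply: sumr_ge0 => i _; rewrite exprn_ge0 ?normr_ge0. Qed.

Lemma sqnorm_eq0 n (u : 'cV[C]_n) : (sqnorm u == 0) = (u == 0).
Proof.
rewrite psumr_eq0; last by move=> i _; rewrite exprn_ge0 ?normr_ge0.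
apply/allP/eqP => [h|-> i _]; last by rewrite mxE normr0 expr0n eqxx.
apply/colP => i; have := h i (mem_index_enum i).
by rewrite expf_eq0 normr_eq0 mxE => /eqP.
Qed.

Lemma F1D k (Z W : 'cV[C]_k.+1) : F1 (Z + W) = F1 Z + F1 W.
Proof. by apply/colP => j; rewrite !mxE mulrDr. Qed.

Lemma F2D k (Z W : 'cV[C]_k.+1) : F2 (Z + W) = F2 Z + F2 W.
Proof. by apply/colP => j; rewrite !mxE mulrDr. Qed.

Lemma neq0iC : 'i%C != 0 :> C.
Proof. exact: neq0Ci. Qed.

Lemma mx22P (A B : 'M[C]_2) : A 0 0 = B 0 0 -> A 0 1 = B 0 1 ->
  A 1 0 = B 1 0 -> A 1 1 = B 1 1 -> A = B.
Proof.
have ord2 (i : 'I_2) : i = 0 \/ i = 1.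
  by case: i => [[|[|//]] hi]; [left|right]; apply: val_inj.
move=> e00 e01 e10 e11; apply/matrixP => i j.
by case: (ord2 i) => ->; case: (ord2 j) => ->.
Qed.

Lemma trmxCD m n (A B : 'M[C]_(m, n)) : (A + B) ^t* = A ^t* + B ^t*.
Proof. by rewrite linearD map_mxD. Qed.

Lemma trmxCB m n (A B : 'M[C]_(m, n)) : (A - B) ^t* = A ^t* - B ^t*.
Proof. by rewrite linearB map_mxB. Qed.

Lemma trmxCZ m n c (A : 'M[C]_(m, n)) : (c *: A) ^t* = Num.conj c *: A ^t*.
Proof. by rewrite linearZ map_mxZ. Qed.

Lemma coef_quadratic (c u v : C) (A B D : 'M[C]_2) i j :
  (c *: (A + u *: B + v *: D)) i j = c * (A i j + u * B i j + v * D i j).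
Proof. by rewrite !mxE. Qed.

Lemma mx22D (a b c d a' b' c' d' : C) :
  mx22 (a + a') (b + b') (c + c') (d + d') = mx22 a b c d + mx22 a' b' c' d'.
Proof. by apply: mx22P; rewrite !mxE. Qed.

Lemma mx22Z (e a b c d : C) :
  mx22 (e * a) (e * b) (e * c) (e * d) = e *: mx22 a b c d.
Proof. by apply: mx22P; rewrite !mxE. Qed.

Lemma block_formDl l k (Z Z' W : 'cV[C]_k.+1) :
  block_form l (Z + Z') W = block_form l Z W + block_form l Z' W.
Proof.
rewrite /block_form F1D F2D !dotTDl mulrDr -mx22D.
by congr mx22; rewrite addrACA.
Qed.

Lemma block_formZl l k c (Z W : 'cV[C]_k.+1) :
  block_form l (c *: Z) W = c *: block_form l Z W.
Proof.
rewrite /block_form F1Z F2Z !dotTZl -mx22Z.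
by congr mx22; rewrite mulrDr mulrCA.
Qed.

Lemma mx22C (a b c d : C) : (mx22 a b c d) ^t* =
  mx22 (Num.conj a) (Num.conj c) (Num.conj b) (Num.conj d).
Proof. by apply: mx22P; rewrite !mxE. Qed.

(** Conjugate symmetry transfers each rule for the first argument to the second. *)
Lemma block_formC l k (Z W : 'cV[C]_k.+1) :
  (block_form l Z W) ^t* = block_form l W Z.
Proof.
rewrite /block_form mx22C !rmorphD !rmorphM /= rmorph_int !dotTC.
by [].
Qed.

Lemma block_form0l l k (W : 'cV[C]_k.+1) : block_form l 0 W = 0.
Proof. by rewrite -[0 in LHS](scale0r 0) block_formZl scale0r. Qed.

Lemma block_form0r l k (Z : 'cV[C]_k.+1) : block_form l Z 0 = 0.
Proof. by rewrite -block_formC block_form0l trmx0 map_mx0. Qed.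

Lemma moment_blockE l k (Z : 'cV[C]_k.+1) : moment_block l Z = block_form l Z Z.
Proof. by rewrite /moment_block !sqnormE. Qed.

Variables (r : nat) (L : 'I_r -> int) (K : 'I_r -> nat).
Local Notation V := 'cV[C]_(\sum_(a < r) (K a).+1).

Definition moment_form (Z W : V) : 'M[C]_2 :=
  \sum_(a < r) block_form (L a) (submxcol Z a) (submxcol W a).

Lemma moment_formDl

 Z Z' W :
  moment_form (Z + Z') W = moment_form Z W + moment_form Z' W.
Proof.
rewrite -big_split; apply: eq_bigr => a _.
by rewrite submxcolD block_formDl.
Qed.

Lemma moment_formZl c Z W : moment_form (c *: Z) W = c *: moment_form Z W.
Proof.
rewrite scaler_sumr; apply: eq_bigr => a _; rewrite -block_formZl.
by congr block_form; apply/matrixP => i j; rewrite !mxE.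
Qed.

Lemma moment_formC Z W : (moment_form Z W) ^t* = moment_form W Z.
Proof.
rewrite /moment_form.
rewrite (big_morph (fun A : 'M[C]_2 => A ^t* ) (@trmxCD 2 2) (_ : 0 ^t* = 0)); last first.
  by rewrite trmx0 map_mx0.
by apply: eq_bigr => a _; rewrite block_formC.
Qed.

(** Different blocks do not interact, so cross terms vanish for disjoint supports. *)
Lemma moment_form_disjoint (Z W : V) :
  (forall c, submxcol Z c = 0 \/ submxcol W c = 0) -> moment_form Z W = 0.
Proof.
move=> h; apply: big1 => c _.
by case: (h c) => ->; rewrite ?block_form0l ?block_form0r.
Qed.

Opaque moment_form.

Lemma moment_formDr Z W W' :
  moment_form Z (W + W') = moment_form Z W + moment_form Z W'.
Proof.
rewrite -(moment_formC (W + W')) moment_formDl trmxCD.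
by congr (_ + _); apply: moment_formC.
Qed.

Lemma moment_formZr c Z W :
  moment_form Z (c *: W) = Num.conj c *: moment_form Z W.
Proof. by rewrite -moment_formC moment_formZl trmxCZ !moment_formC. Qed.

Lemma moment_formulaE Z :
  moment_formula L Z = ('i%C / sqnorm Z) *: moment_form Z Z.
Proof. by congr (_ *: _); apply: eq_bigr => a _; rewrite moment_blockE. Qed.

Lemma conj_real (t : R) : Num.conj (t%:C) = t%:C.
Proof. by rewrite conj_Creal // complex_real. Qed.

Lemma moment_form_line Z W (t : R) :
  moment_form (Z + t%:C *: W) (Z + t%:C *: W) = moment_form Z Z +
  t%:C *: (moment_form Z W + moment_form W Z) + (t ^+ 2)%:C *: moment_form W W.
Proof.
rewrite moment_formDl !moment_formDr !moment_formZl !moment_formZr conj_real.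
move: (moment_form Z Z) (moment_form Z W) (moment_form W Z) (moment_form W W).
by move=> A B D E; rewrite rmorphXn expr2 -scalerA !scalerDr !addrA.
Qed.

Lemma sqnorm_line n (Z W : 'cV[C]_n) (t : R) : sqnorm (Z + t%:C *: W) =
  sqnorm Z + t%:C * (dotT Z W + dotT W Z) + (t ^+ 2)%:C * sqnorm W.
Proof.
have E u : dotT u (Z + t%:C *: W) = dotT u Z + t%:C * dotT u W.
  by rewrite -dotTC dotTDl dotTZl rmorphD rmorphM /= !dotTC conj_real.
rewrite !sqnormE E !dotTDl !dotTZl.
move: (dotT Z Z) (dotT Z W) (dotT W Z) (dotT W W) => a b c d.
by rewrite rmorphXn /=; move: (t%:C) => u; ring.
Qed.

End MomentForm.

(** * The kernel of an infinitesimal symmetry *)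

Section Kernel.
Variable R : realType.
Local Notation C := R[i].

(* Compare the lowest order terms of the equation at [t], where [m] is the     *)
(* multiplicity of [t] as a root of [p].                                      *)
Lemma root_first_order_ode (F : fieldType) (p Q lin : {poly F}) (t : F) :
  p != 0 -> Q * p^`() + lin * p = 0 -> root Q t ->
  exists2 m, (m < size p)%N & Q^`().[t] *+ m + lin.[t] = 0.
Proof.
move=> p0 ode /factor_theorem [Q1 QE].
have [m [q]] := multiplicity_XsubC p t; rewrite p0 /= => qt pE.
have q0 : q != 0 by apply: contraNneq qt => ->; rewrite root0.
exists m.
  rewrite pE size_Mmonic ?monic_exp ?monicXsubC // size_exp_XsubC addnS /=.
  by rewrite -subn_gt0 addnK size_poly_gt0.
(* Every term of the equation carries the factor [u ^+ m]. Once it is cancelled, evaluation at [t]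
   leaves the claim times [q.[t]], which is nonzero. *)
pose u := 'X - t%:P : {poly F}.
have u'E : u^`() = 1 by rewrite derivB derivX derivC subr0.
have E : Q * p^`() + lin * p =
    (Q1 * (u * q^`() + q *+ m) + lin * q) * u ^+ m.
  rewrite pE QE -/u derivM deriv_exp u'E mul1r.
  case: m {pE} => [|m]; first by rewrite expr0 !mulr0n; ring.
  by rewrite /= exprS -mulr_natr -[in RHS]mulr_natr; ring.
have u0 : u ^+ m != 0 by rewrite expf_neq0 // polyXsubC_eq0.
have /eqP := ode; rewrite E mulf_eq0 (negPf u0) orbF => /eqP.
move=> /(congr1 (fun r => r.[t])).
rewrite !(hornerE, hornerMn) /= subrr mul0r add0r QE derivM /= u'E.
rewrite !(hornerE, hornerMn) /= subrr mulr0 add0r => h.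
apply: (mulIf (x := q.[t])) => //.
by rewrite mul0r -h mulrDl mulrnAl -mulrnAr.
Qed.

(** * The action of a matrix on one block and its polynomial model *)

Variable k : nat.
Implicit Types (Z : 'cV[C]_k.+1) (n : 'I_k.+1).

(** Extension of the coordinates by zero, so that neighbours of an index can be named without range
    conditions. *)
Definition coord0 Z (j : nat) : C :=
  oapp (fun i : 'I_k.+1 => Z i 0) 0 (insub j).

Lemma coord0E Z n : coord0 Z n = Z n 0.
Proof. by rewrite /coord0 valK. Qed.

Lemma coord0_out Z j : (k < j)%N -> coord0 Z j = 0.
Proof. by move=> kj; rewrite /coord0 insubN // -leqNgt. Qed.

Lemma sum_pick m (g : nat -> C) (j : nat) :
  \sum_(i < m) g i * (i == j :> nat)%:R = if (j < m)%N then g j else 0.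
Proof.
case: ltnP => jm.
  rewrite (bigD1 (Ordinal jm)) //= eqxx mulr1n mulr1 big1 ?addr0 // => i ij.
  by rewrite (_ : (_ == _ :> nat) = false) ?mulr0 //; apply: negbTE.
rewrite big1 // => i _; rewrite (_ : (_ == _ :> nat) = false) ?mulr0 //.
by apply/eqP => ij; have := ltn_ord i; rewrite ij ltnNge jm.
Qed.

Let sqr (m : nat) : C := (Num.sqrt (m%:R : R))%:C.

Lemma sqr_conj m : Num.conj (sqr m) = sqr m.
Proof. exact: conj_real. Qed.

Lemma sqrM m m' : sqr m * sqr m' = sqr (m * m').
Proof. by rewrite /sqr -rmorphM -sqrtrM ?ler0n // natrM. Qed.

Lemma sqr_sqr m : sqr (m * m) = m%:R.
Proof. by rewrite /sqr natrM -expr2 sqrtr_sqr ger0_norm ?ler0n // rmorph_nat. Qed.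

Lemma F1_coord Z (i : 'I_k) : F1 Z i 0 = sqr (k - i) * coord0 Z i.
Proof. by rewrite mxE -[X in coord0 Z X]/(val (widen_ord (leqnSn k) i)) coord0E. Qed.

Lemma F2_coord Z (i : 'I_k) : F2 Z i 0 = sqr i.+1 * coord0 Z i.+1.
Proof. by rewrite mxE -(coord0E Z (lift ord0 i)) lift0. Qed.

Lemma coord0_delta n (j : nat) : coord0 (delta_mx n 0) j = (j == n :> nat)%:R.
Proof.
case: (ltnP j k.+1) => jk.
  by rewrite -[j]/(val (Ordinal jk)) coord0E mxE eqxx andbT.
rewrite coord0_out // (_ : (_ == _ :> nat) = false) //.
by apply/eqP => ij; have := ltn_ord n; rewrite -ij ltnNge jk.
Qed.

Lemma conj_natb (b : bool) : Num.conj (b%:R : C) = b%:R.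
Proof. exact: rmorph_nat. Qed.

Lemma dotT_delta Z n : dotT Z (delta_mx n 0) = Z n 0.
Proof.
rewrite dotTE (bigD1 n) //= mxE !eqxx rmorph_nat mulr1n mulr1 big1 ?addr0 // => i ni.
by rewrite mxE (negPf ni) rmorph_nat mulr0.
Qed.

Lemma dotT_F1F1 Z n : dotT (F1 Z) (F1 (delta_mx n 0)) = (k - n)%:R * Z n 0.
Proof.
rewrite dotTE (eq_bigr (fun i : 'I_k =>
  ((k - i)%:R * coord0 Z i) * (i == n :> nat)%:R)) => [|i _].
  rewrite (sum_pick k (fun i => (k - i)%:R * coord0 Z i)) coord0E.
  case: ltnP => // kn; rewrite (_ : k - n = 0)%N ?mul0r //.
  by apply/eqP; rewrite subn_eq0.
rewrite !F1_coord coord0_delta rmorphM /= sqr_conj conj_natb -sqr_sqr -sqrM.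
by move: (sqr _) (coord0 _ _) (_%:R) => a b c; ring.
Qed.

Lemma dotT_F2F2 Z n : dotT (F2 Z) (F2 (delta_mx n 0)) = n%:R * Z n 0.
Proof.
rewrite dotTE (eq_bigr (fun i : 'I_k =>
  (i.+1%:R * coord0 Z i.+1) * (i.+1 == n :> nat)%:R)) => [|i _].
  rewrite -coord0E; case: (val n) (ltn_ord n) => [_|m mk].
    by rewrite big1 ?mul0r // => i _; rewrite mulr0.
  by rewrite (sum_pick k (fun i => i.+1%:R * coord0 Z i.+1)) -ltnS mk.
rewrite !F2_coord coord0_delta rmorphM /= sqr_conj conj_natb -sqr_sqr -sqrM.
by move: (sqr _) (coord0 _ _) (_%:R) => a b c; ring.
Qed.

Lemma dotT_F2F1 Z n :
  dotT (F2 Z) (F1 (delta_mx n 0)) = sqr (n.+1 * (k - n)) * coord0 Z n.+1.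
Proof.
rewrite dotTE (eq_bigr (fun i : 'I_k =>
  (sqr (i.+1 * (k - i)) * coord0 Z i.+1) * (i == n :> nat)%:R)) => [|i _].
  rewrite (sum_pick k (fun i => sqr (i.+1 * (k - i)) * coord0 Z i.+1)).
  by case: ltnP => // kn; rewrite coord0_out ?mulr0.
rewrite F1_coord F2_coord coord0_delta rmorphM /= sqr_conj conj_natb -sqrM.
by move: (sqr _) (sqr _) (coord0 _ _) (_%:R) => a d b c; ring.
Qed.

Lemma dotT_F1F2 Z n :
  dotT (F1 Z) (F2 (delta_mx n 0)) = sqr (n * (k - n).+1) * coord0 Z n.-1.
Proof.
rewrite dotTE (eq_bigr (fun i : 'I_k =>
  (sqr (i.+1 * (k - i)) * coord0 Z i) * (i.+1 == n :> nat)%:R)) => [|i _].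
  case: (val n) (ltn_ord n) => [_|m mk].
    rewrite big1 => [|i _]; last by rewrite mulr0.
    by rewrite mul0n /sqr sqrtr0 mul0r.
  rewrite (sum_pick k (fun i => sqr (i.+1 * (k - i)) * coord0 Z i)) -ltnS mk.
  by rewrite -subSn //.
rewrite F1_coord F2_coord coord0_delta rmorphM /= sqr_conj conj_natb -sqrM.
by move: (sqr _) (sqr _) (coord0 _ _) (_%:R) => a d b c; ring.
Qed.

Lemma tr_mx22 (a b c d : C) (xi : 'M[C]_2) : \tr (mx22 a b c d *m xi) =
  a * xi 0 0 + b * xi 1 0 + c * xi 0 1 + d * xi 1 1.
Proof.
rewrite /mxtrace big_ord_recl big_ord1 !mxE !big_ord_recl !big_ord0 !mxE /=.
rewrite (_ : lift ord0 ord0 = 1); last exact: val_inj.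
by rewrite !addr0 addrA.
Qed.

(** In the weight basis [xi] acts by a tridiagonal matrix. At [n = 0] the default [n.-1 = 0] is
    harmless, its coefficient being the root of zero; at [n = k] the coordinate [n.+1] is zero. *)
Lemma tr_block_form_delta l Z n xi :
  \tr (block_form l Z (delta_mx n 0) *m xi) =
  ((k - n)%:R * xi 0 0 + n%:R * xi 1 1 + l%:~R * (xi 0 0 + xi 1 1)) * Z n 0 +
  sqr (n.+1 * (k - n)) * xi 1 0 * coord0 Z n.+1 +
  sqr (n * (k - n).+1) * xi 0 1 * coord0 Z n.-1.
Proof.
rewrite tr_mx22 dotT_F1F1 dotT_F2F2 dotT_F1F2 dotT_F2F1 dotT_delta.
move: (xi 0 0) (xi 0 1) (xi 1 0) (xi 1 1) (sqr _) (sqr _) (Z n 0).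
move: (coord0 _ _) (coord0 _ _) (l%:~R) (n%:R) ((k - n)%:R).
by move=> *; ring.
Qed.

(* With this normalization the Lie algebra acts by first order differential   *)
(* operators with polynomial coefficients.                                    *)
Let form_poly Z : {poly C} := \poly_(j < k.+1) (sqr 'C(k, j) * coord0 Z j).

Lemma form_poly_coef Z j : (form_poly Z)`_j = sqr 'C(k, j) * coord0 Z j.
Proof. by rewrite coef_poly; case: ltnP => // kj; rewrite coord0_out ?mulr0. Qed.

Lemma form_poly_neq0 Z : Z != 0 -> form_poly Z != 0.
Proof.
apply: contra_neq => p0; apply/colP => n; rewrite mxE.
have /eqP := form_poly_coef Z n; rewrite p0 coef0 eq_sym mulf_eq0 coord0E.
case/orP => [|/eqP //]; rewrite -[0]/((0 : R)%:C) => /eqP /complexI /eqP.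
by rewrite sqrtr_eq0 lern0 -leqn0 leqNgt bin_gt0 -ltnS ltn_ord.
Qed.

(** The roots of binomials absorb the roots in the matrix entries and leave integer coefficients;
    under the root this is [mul_bin_left]. *)
Lemma sqr_bin_succ j :
  sqr 'C(k, j) * sqr (j.+1 * (k - j)) = j.+1%:R * sqr 'C(k, j.+1).
Proof.
rewrite -(sqr_sqr j.+1) !sqrM; congr sqr.
by rewrite -mulnA [('C(k, j) * _)%N]mulnCA [('C(k, j) * _)%N]mulnC -mul_bin_left.
Qed.

Lemma sqr_bin_pred j : (j < k)%N ->
  sqr 'C(k, j.+1) * sqr (j.+1 * (k - j)) = (k - j)%:R * sqr 'C(k, j).
Proof.
move=> jk; rewrite -(sqr_sqr (k - j)) !sqrM; congr sqr.
by rewrite mulnA [('C(k, j.+1) * _)%N]mulnC mul_bin_left mulnAC.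
Qed.

(** Pairing with the basis vectors yields a three-term recursion for neighbouring coefficients of
    [form_poly Z], which is the differential equation read coefficient by coefficient. *)
Lemma form_poly_ode l Z (xi : 'M[C]_2) :
  (forall W, \tr (block_form l Z W *m xi) = 0) ->
  ((xi 1 0)%:P + (xi 1 1 - xi 0 0) *: 'X - xi 0 1 *: 'X^2) * (form_poly Z)^`() +
  ((k%:R * xi 0 0 + l%:~R * (xi 0 0 + xi 1 1))%:P + (k%:R * xi 0 1) *: 'X) *
    form_poly Z = 0.
Proof.
move=> h; apply/polyP => j.
have recE (n : 'I_k.+1) : ((k - n)%:R * xi 0 0 + n%:R * xi 1 1 +
      l%:~R * (xi 0 0 + xi 1 1)) * (form_poly Z)`_n +
    n.+1%:R * xi 1 0 * (form_poly Z)`_n.+1 +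
    sqr 'C(k, n) * sqr (n * (k - n).+1) * xi 0 1 * coord0 Z n.-1 = 0.
  have := congr1 (fun c => sqr 'C(k, n) * c) (h (delta_mx n 0)).
  rewrite mulr0 => e; rewrite -[RHS]e tr_block_form_delta !form_poly_coef -coord0E.
  rewrite !mulrDr; congr (_ + _ + _).
  - by rewrite mulrCA.
  - by rewrite !mulrA sqr_bin_succ (mulrAC _ (xi 1 0)).
  - by rewrite !mulrA.
rewrite -!mul_polyC.
move: recE; move: (xi 0 0) (xi 0 1) (xi 1 0) (xi 1 1) (l%:~R) => {h} x b' b y m recE.
have -> (a q c d e p p' X : {poly C}) :
    (a + q * X - c * X ^+ 2) * p' + (d + e * X) * p =
    a * p' + q * (X * p') - c * (X * (X * p')) + d * p + e * (X * p) by ring.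
rewrite !(coefD, coefN) !coefCM !coefXM !coef_deriv coef0.
case: j => [|j] /=.
  have sqr0 : sqr 0 = 0 by rewrite /sqr sqrtr0.
  have := recE ord0; rewrite /= mul0n sqr0 subn0 => e.
  rewrite -[RHS]e; move: (sqr _) (coord0 _ _) (form_poly Z)`_0 (form_poly Z)`_1 (k%:R).
  by move=> *; ring.
have -> : (if j == 0 then 0 else (form_poly Z)`_j.-1.+1 *+ j.-1.+1) =
  (form_poly Z)`_j *+ j by case: j.
rewrite -(mulr_natl (form_poly Z)`_j) -(mulr_natl (form_poly Z)`_j.+1).
rewrite -(mulr_natl (form_poly Z)`_j.+2).
have [jk|kj] := ltnP j k.
  have := recE (Ordinal (jk : (j.+1 < k.+1)%N)); rewrite /= subnSK //.
  rewrite sqr_bin_pred // -!mulrA (mulrC b') [in X in _ + X](mulrA (sqr _)).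
  rewrite -form_poly_coef (natrB _ (jk : (j.+1 <= k)%N)) (natrB _ (ltnW jk)).
  move=> e; rewrite -[RHS]e.
  move: (form_poly Z)`_j (form_poly Z)`_j.+1 (form_poly Z)`_j.+2 => d0 d1 d2.
  move: (k%:R) (j%:R) (j.+1%:R) (j.+2%:R) => k' j0 j1 j2.
  by ring.
(* Here [k <= j], beyond the recursion. In degree [k.+1] the two contributions of the top
   coefficient cancel, and in higher degrees every term is zero. *)
have p0 i : (j < i)%N -> (form_poly Z)`_i = 0.
  move=> ji; rewrite form_poly_coef coord0_out ?mulr0 //.
  exact: leq_ltn_trans kj ji.
rewrite (p0 j.+1) // (p0 j.+2) //.
move: kj; rewrite leq_eqVlt => /orP [/eqP ->|kj]; first by ring.
rewrite (form_poly_coef _ j) coord0_out //; by ring.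
Qed.

(* [al] is the eigenvalue of [xi] given by a root [t] of the leading          *)
(* coefficient, and [j] is the multiplicity of [t] in the polynomial of [Z].  *)
Lemma annihilator_weight l Z (xi : 'M[C]_2) :
  Z != 0 -> (xi 0 1 = 0 -> xi 1 0 = 0) ->
  (forall W, \tr (block_form l Z W *m xi) = 0) ->
  exists (j : 'I_k.+1) (al : C),
    [/\ (al - xi 0 0) * (al - xi 1 1) = xi 0 1 * xi 1 0
      & ((k - j)%:R + l%:~R) * al +
        (j%:R + l%:~R) * (xi 0 0 + xi 1 1 - al) = 0].
Proof.
move=> Z0 xi01 /form_poly_ode; move: (form_poly_neq0 Z0).
have : (size (form_poly Z) <= k.+1)%N by exact: size_poly.
move: (form_poly Z) => p szp p0.
move: (xi 0 0) (xi 0 1) (xi 1 0) (xi 1 1) xi01 => x b' b y b'0 ode.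
(* If [b' = 0] then [b = 0] by hypothesis and [0] is a root, which excludes a nonzero constant.
   Otherwise the degree is two and the field is algebraically closed. *)
have [t Qt] : exists t, b + (y - x) * t - b' * t ^+ 2 = 0.
  have [/[dup] b'E /b'0 ->|b'N] := eqVneq b' 0.
    by exists 0; rewrite b'E; ring.
  have sz : size (b%:P + (y - x) *: 'X - b' *: 'X^2) = 3%N.
    have sz2 : size (- (b' *: 'X^2)) = 3%N.
      by rewrite size_polyN size_scale // size_polyXn.
    rewrite addrC size_polyDl sz2 //.
    apply: leq_ltn_trans (size_polyD _ _) _; rewrite gtn_max size_polyC.
    rewrite (leq_ltn_trans (leq_b1 _)) //=.
    by rewrite (leq_ltn_trans (size_scale_leq _ _)) // size_polyX.
  have /closed_rootP [t /rootP Qt] :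
    size (b%:P + (y - x) *: 'X - b' *: 'X^2) != 1%N by rewrite sz.
  by exists t; move: Qt; rewrite !hornerE.
have Qt' : root (b%:P + (y - x) *: 'X - b' *: 'X^2) t.
  by apply/rootP; rewrite -[RHS]Qt !hornerE; ring.
have [j jp] := root_first_order_ode p0 ode Qt'.
rewrite derivB derivD derivC !derivZ derivX derivXn !(hornerE, hornerMn) /= => jE.
have jk : (j < k.+1)%N by apply: leq_trans jp szp.
(* The quadratic equation for [t] says that the column [(1, t)] is an eigenvector of [xi]; the first
   coordinate of its image is the eigenvalue [x + b' * t]. *)
exists (Ordinal jk), (x + b' * t); split.
  transitivity (b' * b - b' * (b + (y - x) * t - b' * t ^+ 2)); first by ring.
  by rewrite Qt mulr0 subr0.
rewrite /= natrB // -jE -mulr_natl; ring.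
Qed.

End Kernel.

(** * The differential of the moment map *)

Section MomentDerivative.
Variable R : realType.
Local Notation C := R[i].

Lemma dotT_sym_real n (u v : 'cV[C]_n) :
  dotT u v + dotT v u = (complex.Re (dotT u v + dotT v u))%:C.
Proof.
have : Num.conj (dotT u v + dotT v u) = dotT u v + dotT v u.
  by rewrite rmorphD /= !dotTC addrC.
case: (_ + _) => x y; case=> /eqP; rewrite -subr_eq0 -opprD oppr_eq0.
by rewrite -mulr2n mulrn_eq0 /= => /eqP ->.
Qed.

Lemma sqnorm_real n (u : 'cV[C]_n) : sqnorm u = (complex.Re (sqnorm u))%:C.
Proof.
have := sqnorm_ge0 u; case: (sqnorm u) => x y.
by rewrite lecE => /andP [/eqP /= -> _].
Qed.

Variables (r : nat) (L : 'I_r -> int) (K : 'I_r -> nat).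
Local Notation N := (\sum_(a < r) (K a).+1).
Local Notation V := 'cV[C]_N.

Opaque moment_form dotT sqnorm.

(** The quotient rule applied to [moment_formulaE] along the real line through [Z] in direction
    [W]. *)
Definition dmoment (Z W : V) : 'M[C]_2 :=
  'i%C *: ((sqnorm Z)^-1 *: (moment_form L Z W + moment_form L W Z) -
    ((dotT Z W + dotT W Z) / sqnorm Z ^+ 2) *: moment_form L Z Z).

Lemma velocity_moment (Z W : V) : Z != 0 ->
  velocity (fun t => moment_formula L (Z + t%:C *: W)) (dmoment Z W).
Proof.
rewrite -sqnorm_eq0 => Z0; apply/velocityP => i j.
have nP := cder_poly2 (sqnorm Z) (dotT Z W + dotT W Z) (sqnorm W).
(* The squared norm is passed through its real part so that [cderV_real] applies. *)
pose n t := complex.Re (sqnorm (Z + t%:C *: W)).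
have nE t : (n t)%:C = sqnorm (Z + t%:C *: W) by rewrite -sqnorm_real.
have n0E : (n 0)%:C = sqnorm Z by rewrite nE scale0r addr0.
have n0 : n 0 != 0.
  by apply: contra_neq Z0 => n0; rewrite -n0E n0.
have dn : is_derive (0 : R) 1 n (complex.Re (dotT Z W + dotT W Z)).
  case: nP => nP _; move: nP; congr is_derive; apply/funext => t.
  by rewrite /n sqnorm_line.
have n1E := dotT_sym_real Z W.
set n1 := complex.Re _ in dn n1E.
pose A := moment_form L Z Z i j; pose D := moment_form L W W i j.
pose B := (moment_form L Z W + moment_form L W Z) i j.
have d := cderMl 'i%C (cderM (cderV_real n0 dn) (cder_poly2 A B D)).
have -> : dmoment Z W i j = 'i%C * (- n1%:C / (n 0)%:C ^+ 2 *
    (A + 0%:C * B + (0 ^+ 2)%:C * D) + ((n 0)%:C)^-1 * B).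
  have E (c q e : C) (M1 M2 : 'M[C]_2) :
    (c *: (q *: M1 - e *: M2)) i j = c * (q * M1 i j - e * M2 i j) by rewrite !mxE.
  rewrite /dmoment E -/A -/B n0E -n1E expr0n /= 2!mul0r !addr0 addrC.
  by rewrite mulNr mulNr.
apply: cder_ext d => t.
by rewrite moment_formulaE moment_form_line nE coef_quadratic -mulrA.
Qed.

Lemma dmomentZ Z W (s : R) : dmoment Z (s%:C *: W) = s%:C *: dmoment Z W.
Proof.
rewrite /dmoment moment_formZr moment_formZl conj_real -scalerDr.
have -> : dotT Z (s%:C *: W) + dotT (s%:C *: W) Z = s%:C * (dotT Z W + dotT W Z).
  by rewrite dotTZl -[dotT Z _]dotTC dotTZl rmorphM /= dotTC conj_real mulrDr.
rewrite -mulrA; move: (_ / _) (_^-1) s%:C => e q c.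
by rewrite !scalerBr !scalerA; congr (_ *: _ - _ *: _); ring.
Qed.

(** The term from differentiating the norm is a multiple of the value at [Z], which [xi]
    annihilates. *)
Lemma tr_dmoment Z W xi : \tr (moment_form L Z Z *m xi) = 0 ->
  \tr (dmoment Z W *m xi) = 'i%C / sqnorm Z *
    (\tr (moment_form L Z W *m xi) + \tr (moment_form L W Z *m xi)).
Proof.
rewrite /dmoment; move: (moment_form L Z Z) (moment_form L Z W) => A B.
move: (moment_form L W Z) => D h.
rewrite -scalemxAl mxtraceZ mulmxBl raddfB /= -!scalemxAl !mxtraceZ h mulr0.
by rewrite subr0 mulmxDl mxtraceD mulrA.
Qed.

(** The homogeneous direction of a chart direction: in chart [i] the [i]-th coordinate stays equal
    to 1, so its velocity is 0. *)
Definition pad (i : 'I_N) (v : 'cV[C]_N.-1) : V :=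
  \col_k oapp (fun j => v j 0) 0 (unlift i k).

Lemma affine_pt_line i (w v : 'cV[C]_N.-1) (c : C) :
  affine_pt i (w + c *: v) = affine_pt i w + c *: pad i v.
Proof.
apply/colP => j; rewrite !mxE; case: (unlift i j) => [l|] /=; first by rewrite !mxE.
by rewrite mulr0 addr0.
Qed.

Lemma padP i (W : V) : W i 0 = 0 -> exists v, W = pad i v.
Proof.
move=> Wi; exists (\col_j W (lift i j) 0); apply/colP => k.
by rewrite mxE; case: unliftP => [j|] -> /=; rewrite ?mxE.
Qed.

Lemma chart_cover (m : Defs.proj R N) : exists i w, chart i w = m.
Proof.
have Z0 := proj_repr_neq0 m; have mE := proj_repr_line m.
set Z := proj_repr m in Z0 mE.
have [i Zi] : exists i, Z i 0 != 0.
  apply/existsP; apply: contraNT Z0 => /existsPn h; apply/eqP/colP => i.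
  by rewrite mxE; apply/eqP; move: (h i); rewrite negbK.
exists i, (\col_j (Z (lift i j) 0 / Z i 0)).
have E : affine_pt i (\col_j (Z (lift i j) 0 / Z i 0)) = (Z i 0)^-1 *: Z.
  apply/colP => k; rewrite !mxE; case: unliftP => [j|] -> /=.
    by rewrite mxE mulrC.
  by rewrite mulVf.
have : line_of (chart i (\col_j (Z (lift i j) 0 / Z i 0))) = line_of m.
  rewrite mE /= E; apply/seteqP; split => W [c ->].
    by exists (c / Z i 0); rewrite scalerA.
  by exists (c * Z i 0); rewrite scalerA mulfK.
by case: (chart _ _) => S HS; case: (m) => S' HS' /= e; subst S';
  congr Proj; apply: Prop_irrelevance.
Qed.

Lemma Phi_chart (i : 'I_N) (w : 'cV[C]_N.-1) :
  Phi L (chart i w) = moment_formula L (affine_pt i w).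
Proof. exact: Phi_class. Qed.

Lemma velocity_Phi (i : 'I_N) (w v : 'cV[C]_N.-1) :
  velocity (fun t : R => Phi L (chart i (w + t%:C *: v)))
    (dmoment (affine_pt i w) (pad i v)).
Proof.
have := velocity_moment (pad i v) (affine_pt_neq0 i w).
congr velocity; apply/funext => t.
by rewrite Phi_chart affine_pt_line.
Qed.

(** [Psi m] is convertible to [diag_part (Phi m)]. *)
Definition diag_part (A : 'M[C]_2) : 'M[C]_2 := diag_mx (\row_j A j j).

Lemma velocity_diag_part (gamma : R -> 'M[C]_2) X :
  velocity gamma X -> velocity (fun t => diag_part (gamma t)) (diag_part X).
Proof.
move=> h i j; rewrite /diag_part.
have E A : diag_mx (\row_j A j j) i j = A i i *+ (i == j) :> C by rewrite !mxE.
rewrite E; apply: (@cder_ext R (fun t => gamma t i i *+ (i == j))) => [t|].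
  by rewrite E.
case: (i == j); last exact: cder_cst.
exact: h.
Qed.

Lemma diff_image_Phi m X : diff_image (@Phi R r L K) m X <->
  exists i w v, chart i w = m /\ X = dmoment (affine_pt i w) (pad i v).
Proof.
split=> [[i [w [v [mE h]]]]|[i [w [v [mE ->]]]]]; exists i, w, v; split=> //.
  exact: velocity_uniq h (velocity_Phi i w v).
exact: velocity_Phi.
Qed.

Lemma diff_image_Psi m X : diff_image (@Psi R r L K) m X <->
  exists i w v, chart i w = m /\ X = diag_part (dmoment (affine_pt i w) (pad i v)).
Proof.
have E i w v := velocity_diag_part (velocity_Phi i w v).
split=> [[i [w [v [mE h]]]]|[i [w [v [mE ->]]]]]; exists i, w, v; split=> //.
  exact: velocity_uniq h (E i w v).
exact: E.
Qed.

End MomentDerivative.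

(** * Blocks of the representation *)

Section Blocks.
Variable R : realType.
Local Notation C := R[i].

Lemma tr_conj (A xi : 'M[C]_2) :
  xi ^t* = xi -> \tr (A ^t* *m xi) = Num.conj (\tr (A *m xi)).
Proof.
move=> xiH; rewrite -[in LHS]xiH mxtrace_mulC -map_mxM -trmx_mul.
by rewrite /mxtrace rmorph_sum; apply: eq_bigr => i _; rewrite !mxE.
Qed.

Opaque block_form.

Lemma tr_block_form l k (Z W : 'cV[C]_k.+1) (xi : 'M[C]_2) :
  \tr (block_form l Z W *m xi) =
  \sum_n Num.conj (W n 0) * \tr (block_form l Z (delta_mx n 0) *m xi).
Proof.
have WE : W = \sum_n W n 0 *: delta_mx n 0.
  by rewrite [LHS]matrix_sum_delta; apply: eq_bigr => i _; rewrite big_ord1.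
pose f (U : 'cV[C]_k.+1) := \tr (block_form l Z U *m xi).
have fD U U' : f (U + U') = f U + f U'.
  rewrite /f -[block_form l Z (U + U')]block_formC block_formDl trmxCD.
  by rewrite mulmxDl mxtraceD; congr (\tr (_ *m xi) + \tr (_ *m xi));
    apply: block_formC.
have fZ c U : f (c *: U) = Num.conj c * f U.
  rewrite /f -[block_form l Z (c *: U)]block_formC block_formZl trmxCZ.
  by rewrite -scalemxAl mxtraceZ block_formC.
have f0 : f 0 = 0 by rewrite -[0 in LHS](scale0r 0) fZ rmorph0 mul0r.
transitivity (f (\sum_n W n 0 *: delta_mx n 0)); first by rewrite -WE.
by rewrite (big_morph f fD f0); apply: eq_bigr => n _; apply: fZ.
Qed.

(** The identity matrix acts on the block by the scalar [k + 2 l]. This links the sign condition of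
    [definite] with the trace of the moment map. *)
Lemma mxtrace_block_form l k (Z W : 'cV[C]_k.+1) :
  \tr (block_form l Z W) = (k%:Z + 2 * l)%:~R * dotT Z W.
Proof.
rewrite -[block_form l Z W]mulmx1 tr_block_form dotTE big_distrr /=.
apply: eq_bigr => n _; rewrite tr_block_form_delta !mxE /=.
rewrite mulr0 mul0r mulr0 mul0r !addr0 natrB; last by rewrite -ltnS ltn_ord.
rewrite !mulr1n !mulr1.
have -> : (k%:Z + 2 * l)%:~R = k%:R + 2 * l%:~R :> C by rewrite intrD intrM.
by move: (Num.conj _) (Z n 0) (l%:~R) (k%:R) (n%:R) => *; ring.
Qed.

Lemma tr_block_form_diag l k (j : 'I_k.+1) (W : 'cV[C]_k.+1) (xi : 'M[C]_2) :
  xi 0 1 = 0 -> xi 1 0 = 0 ->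
  \tr (block_form l (delta_mx j 0) W *m xi) =
  Num.conj (W j 0) * (((k - j)%:R + l%:~R) * xi 0 0 + (j%:R + l%:~R) * xi 1 1).
Proof.
move=> x01 x10; rewrite tr_block_form (bigD1 j) //= big1 ?addr0 => [|n nj].
  rewrite tr_block_form_delta x01 x10 !mulr0 !mul0r !addr0 mxE !eqxx mulr1n.
  by congr (_ * _); ring.
by rewrite tr_block_form_delta x01 x10 !mulr0 !mul0r !addr0 mxE (negPf nj) !mulr0.
Qed.

Transparent block_form.

(** Off-diagonal entries only link neighbouring indices, and the hypotheses exclude these. *)
Lemma block_form_delta l k (j j' : 'I_k.+1) : (j'.+1 != j) -> (j.+1 != j') ->
  block_form l (delta_mx j 0 : 'cV[C]_k.+1) (delta_mx j' 0) =
  (j == j')%:R *: mx22 ((k - j)%:R + l%:~R) 0 0 (j%:R + l%:~R).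
Proof.
move=> jj' j'j; rewrite /block_form dotT_F1F1 dotT_F2F2 dotT_F1F2 dotT_F2F1 dotT_delta.
rewrite !coord0_delta mxE eqxx andbT (negPf jj') mulr0 -mx22Z !mulr0 (eq_sym j').
have -> : (Num.sqrt (j' * (k - j').+1)%:R : R)%:C * (j'.-1 == j)%:R = 0 :> C.
  case: (posnP j') => [->|j'0]; first by rewrite mul0n sqrtr0 mul0r.
  by rewrite -eqSS prednK // eq_sym (negPf j'j) mulr0.
have [->|] := eqVneq j j'; last by rewrite !(mulr0, mul0r, addr0).
by rewrite !mulr1 !mul1r.
Qed.

Opaque block_form.

Variables (r : nat) (L : 'I_r -> int) (K : 'I_r -> nat).
Local Notation N := (\sum_(a < r) (K a).+1).
Local Notation V := 'cV[C]_N.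

(** Block sizes depend on the index, so placing [v] at an index equal to [a] takes a transport along
    the equality. *)
Definition inject_block (a : 'I_r) (v : 'cV[C]_(K a).+1) : V :=
  \mxcol_b (match a =P b with
    | ReflectT e => eq_rect a (fun c => 'cV[C]_(K c).+1) v b e
    | ReflectF _ => 0
    end).

Lemma inject_blockK a v : submxcol (inject_block v) a = v.
Proof. by rewrite mxcolK; case: eqP => // e; rewrite (eq_axiomK e). Qed.

Lemma inject_block_off a b v : a != b ->
  submxcol (@inject_block a v) b = 0.
Proof. by rewrite mxcolK; case: eqP. Qed.

Lemma moment_form_injectr a (Z : V) v : moment_form L Z (@inject_block a v) =
  block_form (L a) (submxcol Z a) v.
Proof.
rewrite /moment_form (bigD1 a) //= inject_blockK big1 ?addr0 // => b ba.
by rewrite inject_block_off 1?eq_sym // block_form0r.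
Qed.

Lemma moment_form_injectl a (W : V) v : moment_form L (@inject_block a v) W =
  block_form (L a) v (submxcol W a).
Proof. by rewrite -moment_formC moment_form_injectr block_formC. Qed.

Lemma block_neq0 (Z : V) : Z != 0 -> exists a, submxcol Z a != 0.
Proof.
move=> Z0; apply/existsP; apply: contraNT Z0 => /existsPn h.
rewrite -(submxcolK Z) -(submxcolK 0); apply/eqP; congr mxcol.
apply/functional_extensionality_dep => a.
by rewrite submxcol0; apply/eqP; rewrite -[_ == _]negbK.
Qed.

Lemma mxtrace_moment_form (Z W : V) : \tr (moment_form L Z W) =
  \sum_a ((K a)%:Z + 2 * L a)%:~R * dotT (submxcol Z a) (submxcol W a).
Proof.
by rewrite /moment_form raddf_sum; apply: eq_bigr => a _; apply: mxtrace_block_form.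
Qed.

Opaque moment_form.

(** Up to the factor [i], the trace is the mean of the numbers [K a + 2 L a] with weights the
    squared norms of the blocks; these numbers share one sign. *)
Lemma definite_trace (Z : V) : definite L K -> Z != 0 ->
  exists2 t : R, \tr (moment_formula L Z) = 'i%C * t%:C &
    forall a, 0 < t * ((K a)%:Z + 2 * L a)%:~R.
Proof.
move=> def Z0; pose kap a : R := ((K a)%:Z + 2 * L a)%:~R.
pose s a := complex.Re (sqnorm (submxcol Z a)).
have sE a : sqnorm (submxcol Z a) = (s a)%:C by exact: sqnorm_real.
have s_ge0 a : 0 <= s a by rewrite -lecR -sE sqnorm_ge0.
pose n := complex.Re (sqnorm Z).
have nE : sqnorm Z = n%:C by exact: sqnorm_real.
have n_gt0 : 0 < n.
  by rewrite -ltcR -nE lt_def sqnorm_eq0 Z0 sqnorm_ge0.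
exists (n^-1 * \sum_a kap a * s a).
  rewrite moment_formulaE mxtraceZ mxtrace_moment_form -mulrA nE rmorphM fmorphV.
  rewrite rmorph_sum; congr (_ * (_ * _)); apply: eq_bigr => a _.
  by rewrite -sqnormE sE rmorphM /= rmorph_int.
have [a0 Za0] := block_neq0 Z0.
have s0 : 0 < s a0 by rewrite -ltcR -sE lt_def sqnorm_eq0 Za0 sqnorm_ge0.
move=> a; rewrite -mulrA; apply: mulr_gt0; first by rewrite invr_gt0.
case: def => def.
  have kp b : 0 < kap b by rewrite /kap ltr0z.
  apply: mulr_gt0; last exact: kp.
  rewrite (bigD1 a0) //=; apply: ltr_pwDl; first exact: mulr_gt0.
  by apply: sumr_ge0 => b _; rewrite mulr_ge0 // ltW.
have kn b : kap b < 0 by rewrite /kap ltrz0.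
rewrite nmulr_lgt0; last exact: kn.
rewrite (bigD1 a0) //=; apply: ltr_nwDl; first by rewrite nmulr_rlt0.
by apply: sumr_le0 => b _; rewrite nmulr_rle0.
Qed.

(* Along the directions [W] with [W i 0 = 0] and their multiples by ['i] the  *)
(* derivative of the paired moment map gives the real and imaginary parts of  *)
(* [\tr (moment_form L Z W *m xi)]; the remaining direction is [Z] itself.    *)
Lemma critical_annihilator i (w : 'cV[C]_N.-1) (xi : 'M[C]_2) :
  xi ^t* = xi ->
  \tr (moment_form L (affine_pt i w) (affine_pt i w) *m xi) = 0 ->
  (forall v, \tr (dmoment L (affine_pt i w) (pad i v) *m xi) = 0) ->
  forall W, \tr (moment_form L (affine_pt i w) W *m xi) = 0.
Proof.
set Z := affine_pt i w => xiH h0 crit.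
pose h W := \tr (moment_form L Z W *m xi).
have hC W : \tr (moment_form L W Z *m xi) = Num.conj (h W).
  by rewrite -moment_formC tr_conj.
have n0 : 'i%C / sqnorm Z != 0.
  by rewrite mulf_neq0 ?invr_eq0 ?sqnorm_eq0 ?affine_pt_neq0 // neq0iC.
have re (W : V) : W i 0 = 0 -> h W + Num.conj (h W) = 0.
  move=> /padP [v ->]; rewrite -(hC (pad i v)).
  have /eqP := etrans (esym (tr_dmoment (pad i v) h0)) (crit v).
  by rewrite mulf_eq0 (negPf n0) => /eqP.
have hZ c W : h (c *: W) = Num.conj c * h W.
  by rewrite /h moment_formZr -scalemxAl mxtraceZ.
have hD W W' : h (W + W') = h W + h W'.
  by rewrite /h moment_formDr mulmxDl mxtraceD.
have zero (W : V) : W i 0 = 0 -> h W = 0.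
  move=> Wi; have := re _ Wi; have := re ('i%C *: W).
  rewrite mxE Wi mulr0 => /(_ erefl); rewrite hZ.
  case: (h W) => x y; move=> /eqP; rewrite eq_complex => /andP [/eqP + _].
  move=> /= e1 /eqP; rewrite eq_complex => /andP [/eqP /= e2 _].
  by apply/eqP; rewrite eq_complex /=; apply/andP; split; apply/eqP; lra.
move=> W; rewrite -/(h W) -(subrK (W i 0 *: Z) W) hD hZ /(h Z) h0 mulr0 addr0.
by apply: zero; rewrite !mxE unlift_none /= mulr1 subrr.
Qed.

(** Test vectors supported in one block where [Z] is nonzero reduce the claim to
    [annihilator_weight]. *)
Lemma annihilator_support (Z : V) (xi : 'M[C]_2) : Z != 0 ->
  (xi 0 1 = 0 -> xi 1 0 = 0) ->
  (forall W, \tr (moment_form L Z W *m xi) = 0) ->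
  exists a (j : 'I_(K a).+1) (al : C),
    [/\ (al - xi 0 0) * (al - xi 1 1) = xi 0 1 * xi 1 0
      & ((K a - j)%:R + (L a)%:~R) * al +
        (j%:R + (L a)%:~R) * (xi 0 0 + xi 1 1 - al) = 0].
Proof.
move=> /block_neq0 [a Za] xi01 h; exists a; apply: annihilator_weight Za xi01 _.
by move=> W; rewrite -moment_form_injectr.
Qed.

End Blocks.

(** * Zeros of the moment maps *)

Section Zeros.
Variable R : realType.
Local Notation C := R[i].
Variables (r : nat) (L : 'I_r -> int) (K : 'I_r -> nat).
Local Notation N := (\sum_(a < r) (K a).+1).
Local Notation V := 'cV[C]_N.
Local Notation kap a := ((K a)%:Z + 2 * L a).

Opaque block_form moment_form dotT sqnorm.

Lemma mx22_scalar (c : C) : mx22 c 0 0 c = c%:M.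
Proof. by apply: mx22P; rewrite !mxE. Qed.

Lemma mxtrace_diag_part (A : 'M[C]_2) : \tr (diag_part A) = \tr A.
Proof. by apply: eq_bigr => i _; rewrite !mxE eqxx mulr1n. Qed.

Lemma block_formDr l k (Z W W' : 'cV[C]_k.+1) :
  block_form l Z (W + W') = block_form l Z W + block_form l Z W'.
Proof.
rewrite -[LHS]block_formC block_formDl trmxCD.
by congr (_ + _); apply: block_formC.
Qed.

(* The sum of a highest and a lowest weight vector; in [Sym^1] these interact *)
(* in the off-diagonal entries, so there they are put into different copies.  *)
Lemma scalar_moment (a : 'I_r) : generic L K ->
  exists (U : V) (rho : R), [/\ 0 < rho, U != 0,
    moment_form L U U = (rho * (kap a)%:~R)%:C%:M
    & forall c, (L c, K c) <> (L a, K a) -> submxcol U c = 0].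
Proof.
move=> gen; pose e0 c : 'cV[C]_(K c).+1 := delta_mx ord0 0.
pose e1 c : 'cV[C]_(K c).+1 := delta_mx ord_max 0.
have inj0 c (v : 'cV[C]_(K c).+1) : v != 0 -> inject_block v != 0 :> V.
  by apply: contra_neq => /(congr1 (fun Z : V => submxcol Z c)); rewrite inject_blockK submxcol0.
have off c d (v : 'cV[C]_(K c).+1) : (L d, K d) <> (L c, K c) ->
    submxcol (inject_block v : V) d = 0.
  by move=> dc; apply: inject_block_off; apply: contra_not_neq dc => ->.
have kapE c : ((kap c)%:~R : R)%:C = (K c)%:R + 2 * (L c)%:~R.
  by rewrite rmorph_int intrD intrM.
have e00 c : block_form (L c) (e0 c) (e0 c) =
    mx22 ((K c)%:R + (L c)%:~R) 0 0 (L c)%:~R.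
  by rewrite block_form_delta // eqxx scale1r subn0 add0r.
have e11 c : block_form (L c) (e1 c) (e1 c) =
    mx22 (L c)%:~R 0 0 ((K c)%:R + (L c)%:~R).
  by rewrite block_form_delta ?eqxx ?scale1r ?subnn ?add0r //= gtn_eqF.
have half : (2^-1 : R)%:C = 2^-1 by rewrite fmorphV rmorph_nat.
have [K1|K1] := eqVneq (K a) 1%N.
  have [|b [c [bc bE cE]]] := gen (L a); first by exists a; rewrite K1.
  have bc' : b != c by apply: contraTneq bc => ->; rewrite ltnn.
  have ea : (L a, K a) = (L a, 1%N) by rewrite K1.
  exists (inject_block (e0 b) + inject_block (e1 c)), 1; split => //.
  - apply/eqP => /(congr1 (fun Z : V => submxcol Z b)).
    rewrite submxcolD inject_blockK inject_block_off 1?eq_sym // addr0 submxcol0.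
    by move=> /colP /(_ ord0) /eqP; rewrite !mxE eqxx oner_eq0.
  - rewrite moment_formDl !moment_formDr !moment_form_injectl !inject_blockK.
    rewrite inject_block_off 1?eq_sym // inject_block_off // !block_form0r.
    rewrite addr0 add0r e00 e11 mul1r kapE.
    case: bE cE => -> -> [-> ->]; rewrite K1 -mx22_scalar -mx22D !addr0.
    by congr mx22; ring.
  - move=> d da; rewrite submxcolD !off ?addr0 //.
      by rewrite cE -ea.
    by rewrite bE -ea.
(* For [K a = 0] highest and lowest weight coincide, and the one basis vector has moment [L a], half
   of [kap a]. *)
have [K0|K0] := eqVneq (K a) 0%N.
  exists (inject_block (e0 a)), 2^-1; split => //.
  - apply: inj0; apply/eqP => /colP /(_ ord0) /eqP.
    by rewrite !mxE eqxx oner_eq0.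
  - rewrite moment_form_injectl inject_blockK e00 rmorphM /= half kapE K0.
    by rewrite !add0r mulKf ?mx22_scalar // pnatr_eq0.
  - by move=> c; apply: off.
have e01 : (ord0 == ord_max :> 'I_(K a).+1) = false.
  by apply: contra_neqF K0 => /eqP /(congr1 val).
exists (inject_block (e0 a + e1 a)), 1; split => //; last by move=> c; apply: off.
- apply: inj0; apply/eqP => /colP /(_ ord0) /eqP.
  by rewrite !mxE eqxx e01 addr0 oner_eq0.
rewrite moment_form_injectl inject_blockK block_formDl !block_formDr e00 e11.
rewrite block_form_delta //=; last by rewrite eq_sym.
rewrite block_form_delta //=; last by rewrite eq_sym.
rewrite (eq_sym ord_max) e01.
rewrite !scale0r addr0 add0r mul1r kapE -mx22_scalar -mx22D !addr0.
by congr mx22; ring.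
Qed.

(** Either some [kap a] vanishes and its scalar vector serves, or two of them have opposite signs
    and the corresponding scalar moments are made to cancel by square roots as coefficients. *)
Lemma zero_moment : generic L K -> ~ definite L K ->
  exists2 U : V, U != 0 & moment_form L U U = 0.
Proof.
move=> gen ndef.
have [[a ka]|nz] := pselect (exists a, kap a = 0).
  have [U [rho [_ U0 UE _]]] := scalar_moment a gen.
  exists U => //; rewrite UE ka mulr0.
  exact: (raddf0 scalar_mx).
have [a ka] : exists a, 0 < kap a.
  apply: contrapT => h; apply: ndef; right => a; rewrite ltNge le_eqVlt.
  apply/negP => /orP [/eqP e|e]; [apply: nz|apply: h]; by exists a.
have [b kb] : exists b, kap b < 0.
  apply: contrapT => h; apply: ndef; left => b; rewrite ltNge le_eqVlt.
  apply/negP => /orP [/eqP e|e]; [apply: nz|apply: h]; by exists b.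
have [U [rho [rho0 U0 UE Uoff]]] := scalar_moment a gen.
have [W [sig [sig0 W0 WE Woff]]] := scalar_moment b gen.
(* [U] lives on blocks of the type of [a] and [W] on those of the type of [b]; the types differ
   because [kap a] and [kap b] do. *)
have dis c : submxcol U c = 0 \/ submxcol W c = 0.
  have [e|/Uoff] := pselect ((L c, K c) = (L a, K a)); last by left.
  right; apply: Woff; rewrite e => - [eL eK].
  by have := lt_trans kb ka; rewrite eL eK ltxx.
pose x := rho * (kap a)%:~R : R; pose y := - (sig * (kap b)%:~R) : R.
have x0 : 0 < x by rewrite mulr_gt0 // ltr0z.
have y0 : 0 < y by rewrite oppr_gt0 pmulr_rlt0 // ltrz0.
pose s := (Num.sqrt y)%:C : C; pose t := (Num.sqrt x)%:C : C.
exists (s *: U + t *: W).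
  have [c Uc] := block_neq0 U0; apply/eqP => /(congr1 (fun Z : V => submxcol Z c)).
  have Wc : submxcol W c = 0 by case: (dis c) => // e; rewrite e eqxx in Uc.
  have E (d : C) (Z : V) : submxcol (d *: Z) c = d *: submxcol Z c.
    by apply/matrixP => i j; rewrite !mxE.
  rewrite submxcol0 submxcolD !E Wc scaler0 addr0 => /eqP.
  rewrite scaler_eq0 (negPf Uc) orbF => /eqP /complexI /eqP.
  by rewrite sqrtr_eq0 leNgt y0.
rewrite moment_formDl !moment_formDr !moment_formZl !moment_formZr.
rewrite (moment_form_disjoint L dis) (@moment_form_disjoint _ _ L _ W U); last first.
  by move=> c; case: (dis c); [right|left].
rewrite UE WE !scaler0 addr0 add0r /s /t !conj_real !scalerA -!rmorphM.
rewrite -!expr2 !sqr_sqrtr ?ltW // -/x -[sig * _]opprK -/y.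
by rewrite !scale_scalar_mx -!rmorphM -raddfD -rmorphD /= mulrN mulrC subrr raddf0.
Qed.

Lemma range_Phi0 : (0 < r)%N -> generic L K ->
  definite L K <-> ~ range (@Phi R r L K) 0.
Proof.
move=> r0 gen; split=> [def [m _ m0]|h].
  have [i [w mE]] := chart_cover m.
  have [t tE tp] := definite_trace def (affine_pt_neq0 i w).
  move: tE; rewrite -Phi_chart mE m0 mxtrace0 => /eqP.
  rewrite eq_sym mulf_eq0 (negPf (neq0iC R)) /= => /eqP /complexI t0.
  by have := tp (Ordinal r0); rewrite t0 mul0r ltxx.
apply: contrapT => /(zero_moment gen) [U U0 UE]; apply: h.
by exists (proj_class U0) => //; rewrite Phi_class moment_formulaE UE scaler0.
Qed.

(** The trace that obstructs zeros of [Phi] only sees the diagonal, and every zero of [Phi] is one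
    of [Psi]. *)
Lemma range_Psi0 : (0 < r)%N -> generic L K ->
  definite L K <-> ~ range (@Psi R r L K) 0.
Proof.
move=> r0 gen; split=> [def [m _ m0]|h].
  have [i [w mE]] := chart_cover m.
  have [t tE tp] := definite_trace def (affine_pt_neq0 i w).
  move: tE; rewrite -Phi_chart mE -mxtrace_diag_part -[diag_part _]/(Psi _ _) m0.
  rewrite mxtrace0 => /eqP.
  rewrite eq_sym mulf_eq0 (negPf (neq0iC R)) /= => /eqP /complexI t0.
  by have := tp (Ordinal r0); rewrite t0 mul0r ltxx.
apply/(range_Phi0 r0 gen) => - [m _ m0]; apply: h; exists m => //.
by rewrite /Psi m0; apply/matrixP => i j; rewrite !mxE mul0rn.
Qed.

End Zeros.

(** * Tangent spaces of the cones *)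

Section Tangent.
Variable R : realType.
Local Notation C := R[i].
Implicit Types (A B W X Y xi : 'M[C]_2) (nu : 'cV[R]_2).

Lemma u2P A : u2 R A <-> forall i j, Num.conj (A j i) = - A i j.
Proof.
split=> [h i j|h]; last by apply/matrixP => i j; rewrite !mxE.
by have := congr1 (fun B : 'M[C]_2 => B i j) h; rewrite !mxE.
Qed.

Lemma u2D A B : u2 R A -> u2 R B -> u2 R (A + B).
Proof. by rewrite /u2 /= => hA hB; rewrite trmxCD hA hB opprD. Qed.

Lemma u2Z (c : R) A : u2 R A -> u2 R (c%:C *: A).
Proof. by rewrite /u2 /= => hA; rewrite trmxCZ hA conj_real scalerN. Qed.

Lemma u2B A B : u2 R A -> u2 R B -> u2 R (A - B).
Proof.
by rewrite /u2 /= => hA hB; rewrite trmxCB hA hB opprD.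
Qed.

Lemma u2_mxtrace A : u2 R A -> exists t : R, \tr A = 'i%C * t%:C.
Proof.
move=> hA; exists (complex.Im (\tr A)).
have : Num.conj (\tr A) = - \tr A.
  by rewrite /mxtrace rmorph_sum -sumrN; apply: eq_bigr => i _; exact: (proj1 (u2P A) hA).
case: (\tr A) => x y [xE]; apply/eqP; rewrite eq_complex /=.
by apply/andP; split; apply/eqP; lra.
Qed.

Lemma u2_mxtrace_mul A xi : u2 R A -> xi ^t* = xi ->
  exists t : R, \tr (A *m xi) = 'i%C * t%:C.
Proof.
move=> hA xiH; exists (complex.Im (\tr (A *m xi))).
have := tr_conj A xiH; rewrite (hA : A ^t* = - A) mulNmx raddfN /=.
case: (\tr (A *m xi)) => x y [xE]; apply/eqP; rewrite eq_complex /=.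
by apply/andP; split; apply/eqP; lra.
Qed.

(** The equations of u(2) are real linear and so pass to derivatives. *)
Lemma velocity_u2 (gamma : R -> 'M[C]_2) X :
  (\forall t \near (0 : R), u2 R (gamma t)) -> velocity gamma X -> u2 R X.
Proof.
move=> gu /velocityP h; apply/u2P => i j.
apply: cder_uniq (cder_conj (h j i)) _.
apply: cder_near (cderN (h i j)); near=> t.
have /u2P gt : u2 R (gamma t) by near: t.
by rewrite gt.
Unshelve. all: by end_near. Qed.

Lemma idiagE nu : idiag nu = mx22 ('i%C * (nu 0 0)%:C) 0 0 ('i%C * (nu 1 0)%:C).
Proof. by apply: mx22P; rewrite !mxE //= ?mulr1n ?mulr0n ?mulr0. Qed.

Lemma idiag_u2 nu : u2 R (idiag nu).
Proof.
rewrite idiagE /u2 /= mx22C rmorph0 !rmorphM /= !conj_real conjCi.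
by rewrite !mulNr; apply: mx22P; rewrite !mxE ?oppr0.
Qed.

Lemma cone_idiag_tr nu A : cone [set idiag nu] A ->
  exists2 c : R, 0 < c & A = c%:C *: idiag nu.
Proof. by move=> [c c0 [X -> ->]]; exists c. Qed.

Lemma coadj_cone_u2 nu A : cone (coadj_orbit nu) A -> u2 R A.
Proof.
move=> [c c0 [X [g gU ->] ->]]; apply: u2Z.
rewrite /u2 /= invmx_unitary // !trmx_mul !map_mxM /= trmxCK mulmxA.
by rewrite (idiag_u2 nu : _ ^t* = - _) mulmxN mulNmx.
Qed.

Lemma mxtrace2 A : \tr A = A 0 0 + A 1 1.
Proof.
rewrite /mxtrace big_ord_recl big_ord1.
by rewrite (_ : lift ord0 ord0 = 1); last exact: val_inj.
Qed.

Lemma det2 A : \det A = A 0 0 * A 1 1 - A 0 1 * A 1 0.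
Proof.
have l0 : lift (0 : 'I_2) 0 = 1 by exact: val_inj.
have l1 : lift (1 : 'I_2) 0 = 0 by exact: val_inj.
have o1 : lift (ord0 : 'I_2) ord0 = 1 by exact: val_inj.
rewrite (expand_det_row _ 0) big_ord_recl big_ord1 /cofactor !det_mx11 !mxE.
by rewrite !o1 ?l0 l1 expr0 expr1 mul1r mulN1r mulrN.
Qed.

Lemma coadj_cone_invariants nu A : cone (coadj_orbit nu) A ->
  exists2 c : R, 0 < c & \tr A = 'i%C * (c * (nu 0 0 + nu 1 0))%:C /\
    \det A = - (c ^+ 2 * (nu 0 0 * nu 1 0))%:C.
Proof.
move=> [c c0 [X [g gU ->] ->]]; exists c => //; split.
  rewrite mxtraceZ mxtrace_mulC mulmxA mulVmx ?unitarymx_unit // mul1mx.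
  rewrite idiagE mxtrace2 !mxE /= -mulrDr mulrCA -rmorphD -rmorphM.
  by [].
have dg : \det g != 0 by rewrite -unitfE -unitmxE unitarymx_unit.
rewrite detZ !det_mulmx det_inv [\det g * _ * _]mulrAC mulfV // mul1r.
rewrite idiagE det2 !mxE /= !rmorphM /=.
transitivity (c%:C ^+ 2 * ((nu 0 0)%:C * (nu 1 0)%:C) * 'i%C ^+ 2).
  by move: c%:C (nu 0 0)%:C (nu 1 0)%:C 'i%C => *; ring.
by rewrite sqr_i mulrN1.
Qed.

Lemma tangent_ray nu (c s : R) : 0 < c ->
  tangent (cone [set idiag nu]) (c%:C *: idiag nu) (s%:C *: idiag nu).
Proof.
move=> c0; have d0 : 0 < 1 + `|s| by rewrite ltr_pwDl.
(* This bound keeps [c + t * s] positive; adding 1 avoids a zero denominator when [s = 0]. *)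
have ht : \forall t \near (0 : R), `|t| < c / (1 + `|s|).
  by apply: nbhs0_lt; rewrite divr_gt0.
exists (fun t => (c + t * s)%:C *: idiag nu); split.
- by rewrite mul0r addr0.
- near=> t; exists (c + t * s); last by exists (idiag nu).
  have : `|t| < c / (1 + `|s|) by near: t; exact: ht.
  rewrite ltr_pdivlMr // => h.
  rewrite -ltrBlDl sub0r; apply: lt_le_trans (_ : - `|t * s| <= _).
    rewrite ltrN2 normrM; apply: le_lt_trans h.
    by rewrite ler_wpM2l // lerDr.
  by rewrite lerNl -normrN ler_norm.
- apply/velocityP => i j; rewrite mxE.
  have := cder_poly2 (c%:C * idiag nu i j) (s%:C * idiag nu i j) 0.
  by apply: cder_ext => t; rewrite !mxE mulr0 addr0 rmorphD rmorphM /=; ring.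
Unshelve. all: by end_near. Qed.

(** The same linear equation holds at every point of the ray, hence for velocities. *)
Lemma tangent_ray_inv nu A X : tangent (cone [set idiag nu]) A X ->
  X 0 0 * (nu 1 0)%:C = X 1 1 * (nu 0 0)%:C.
Proof.
move=> [gamma [_ gS /velocityP gX]].
have d : cder (fun t => gamma t 0 0 * (nu 1 0)%:C - gamma t 1 1 * (nu 0 0)%:C)
    (X 0 0 * (nu 1 0)%:C - X 1 1 * (nu 0 0)%:C).
  apply: cderD; last apply: cderN; rewrite mulrC.
    by apply: cder_ext (cderMl (nu 1 0)%:C (gX 0 0)) => t; rewrite mulrC.
  by apply: cder_ext (cderMl (nu 0 0)%:C (gX 1 1)) => t; rewrite mulrC.
apply/eqP; rewrite -subr_eq0; apply/eqP; apply: (cder_uniq d).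
apply: cder_near (cder_cst 0); near=> t.
have [c _ ->] : exists2 c : R, 0 < c & gamma t = c%:C *: idiag nu.
  by apply: cone_idiag_tr; near: t.
rewrite idiagE !mxE /=; move: (nu 0 0)%:C (nu 1 0)%:C c%:C 'i%C => *; ring.
Unshelve. all: by end_near. Qed.

(* The cone is contained in the quadric [nu1 nu2 tr^2 = (nu1 + nu2)^2 det],   *)
(* whose differential is computed at the diagonal point.                      *)
Lemma tangent_coadj_diag nu (c : R) X : nu 0 0 != nu 1 0 ->
  nu 0 0 + nu 1 0 != 0 -> c != 0 ->
  tangent (cone (coadj_orbit nu)) (c%:C *: idiag nu) X ->
  X 0 0 * (nu 1 0)%:C = X 1 1 * (nu 0 0)%:C.
Proof.
move=> nu12 s0 c0 [gamma [g0 gS /velocityP gX]].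
set n1 := (nu 0 0)%:C; set n2 := (nu 1 0)%:C.
pose q a b d e : C := n1 * n2 * ((a + e) * (a + e)) -
  (n1 + n2) * (n1 + n2) * (a * e - b * d).
have d := cderD (cderMl (n1 * n2) (cderM (cderD (gX 0 0) (gX 1 1))
    (cderD (gX 0 0) (gX 1 1)))) (cderN (cderMl ((n1 + n2) * (n1 + n2))
   (cderD (cderM (gX 0 0) (gX 1 1)) (cderN (cderM (gX 0 1) (gX 1 0)))))).
have d0 : cder (fun t => q (gamma t 0 0) (gamma t 0 1) (gamma t 1 0) (gamma t 1 1)) 0.
  apply: cder_near (cder_cst 0); near=> t.
  have [e _ [trE detE]] : exists2 e : R, 0 < e &
      \tr (gamma t) = 'i%C * (e * (nu 0 0 + nu 1 0))%:C /\
      \det (gamma t) = - (e ^+ 2 * (nu 0 0 * nu 1 0))%:C.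
    by apply: coadj_cone_invariants; near: t.
  rewrite /q -det2 -mxtrace2 trE detE !rmorphM rmorphD /n1 /n2 /=.
  move: (nu 0 0)%:C (nu 1 0)%:C e%:C => a b f.
  transitivity (a * b * (f * (a + b)) ^+ 2 * ('i%C ^+ 2 + 1)); last by ring.
  by rewrite sqr_i addNr mulr0.
have := cder_uniq d d0; rewrite g0 idiagE !mxE /=.
move: (X 0 0) (X 0 1) (X 1 0) (X 1 1) => x u v y e.
(* At the diagonal point the differential of the quadric is a multiple of [x * n2 - y * n1], with a
   factor that the hypotheses make nonzero. *)
have : ((nu 0 0 + nu 1 0) * c * (nu 0 0 - nu 1 0))%:C * 'i%C *
    (x * n2 - y * n1) = 0.
  rewrite !rmorphM rmorphD rmorphB /= -e /n1 /n2.
  by move: (nu 0 0)%:C (nu 1 0)%:C c%:C 'i%C => *; ring.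
move=> /eqP; rewrite mulf_eq0 mulf_eq0 (negPf (neq0iC R)) orbF.
case/orP => [/eqP /complexI /eqP|]; last by rewrite subr_eq0 => /eqP.
by rewrite !mulf_eq0 (negPf s0) (negPf c0) subr_eq0 (negPf nu12).
Unshelve. all: by end_near. Qed.

End Tangent.

(** * Curves in the cone over a coadjoint orbit *)

Section CoadjointTangent.
Variable R : realType.
Local Notation C := R[i].
Implicit Types (A B W X Y xi : 'M[C]_2) (nu : 'cV[R]_2).

Lemma mulmx2 A B i j : (A *m B) i j = A i 0 * B 0 j + A i 1 * B 1 j.
Proof.
rewrite mxE big_ord_recl big_ord1.
by rewrite (_ : lift ord0 ord0 = 1); last exact: val_inj.
Qed.

Lemma mxtrace_mul2 A B : \tr (A *m B) =
  A 0 0 * B 0 0 + A 0 1 * B 1 0 + (A 1 0 * B 0 1 + A 1 1 * B 1 1).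
Proof. by rewrite mxtrace2 !mulmx2. Qed.

(** Cayley-Hamilton in size two. *)
Lemma traceless_sqr Y : \tr Y = 0 -> Y *m Y = - (\det Y)%:M.
Proof.
rewrite mxtrace2 det2 => /eqP; rewrite addrC addr_eq0 => /eqP y11.
apply: mx22P; rewrite mulmx2 !mxE y11 /= ?mulr1n ?mulr0n;
  move: (Y 0 0) (Y 0 1) (Y 1 0) => *; ring.
Qed.

(** The square of [ad A] is scalar on traceless matrices orthogonal to [A]. When the scalar is
    nonzero, such a [W] is a commutator with [A], that is, tangent to the orbit. *)
Lemma double_commutator A W : \tr W = 0 -> \tr (W *m A) = 0 ->
  (A *m W - W *m A) *m A - A *m (A *m W - W *m A) =
  (4 * \det A - \tr A ^+ 2) *: W.
Proof.
rewrite mxtrace2 mxtrace_mul2 det2 mxtrace2 => /eqP.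
rewrite addrC addr_eq0 => /eqP w11 h.
(* [V] is [2 A - tr A]; for traceless [W] the two sides differ by [tr (W A)] times [V]. *)
pose V := mx22 (A 0 0 - A 1 1) (2 * A 0 1) (2 * A 1 0) (A 1 1 - A 0 0).
apply/eqP; rewrite -subr_eq0; apply/eqP; rewrite -[RHS](scale0r V) -h /V.
apply: mx22P; rewrite !(mulmx2, mxE) /= ?(mulmx2, mxE) w11;
  move: (W 0 0) (W 0 1) (W 1 0) (A 0 0) (A 0 1) (A 1 0) (A 1 1) => *; ring.
Qed.

Lemma trmxCM A B : (A *m B) ^t* = B ^t* *m A ^t*.
Proof. by rewrite trmx_mul map_mxM. Qed.

Lemma cone_scale nu (s : R) A : 0 < s ->
  cone (coadj_orbit nu) A -> cone (coadj_orbit nu) (s%:C *: A).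
Proof.
move=> s0 [c c0 [X OX ->]]; exists (s * c); first exact: mulr_gt0.
by exists X => //; rewrite scalerA rmorphM.
Qed.

(* For traceless [Y] in u(2), [1 + Y] is a positive multiple of a unitary     *)
(* matrix, since [Y^2] is a nonpositive scalar.                               *)
Lemma cone_cayley nu Y A : u2 R Y -> \tr Y = 0 -> cone (coadj_orbit nu) A ->
  cone (coadj_orbit nu) ((1%:M + Y) *m A *m (1%:M - Y)).
Proof.
move=> Yu Y0 [c c0 [X [g gU ->] ->]].
have [d d0 dE] : exists2 d : R, 0 <= d & \det Y = d%:C.
  have Yc := proj1 (u2P Y) Yu.
  have y11 : Y 1 1 = - Y 0 0.
    by apply/eqP; rewrite -addr_eq0 addrC -mxtrace2 Y0.
  have E : \det Y = `|Y 0 0| ^+ 2 + `|Y 1 0| ^+ 2.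
    rewrite det2 y11 !normCK !Yc.
    by move: (Y 0 0) (Y 0 1) (Y 1 0) => *; ring.
  exists (complex.Re (\det Y)).
    by rewrite E -!add_Re2_Im2 -rmorphD /= addr_ge0 // addr_ge0 ?sqr_ge0.
  by rewrite E -!add_Re2_Im2 -rmorphD.
pose s := Num.sqrt (1 + d).
have s0 : 0 < s by rewrite sqrtr_gt0 ltr_pwDl.
have sC : s%:C != 0 :> C.
  by apply/eqP => /complexI /eqP; rewrite gt_eqF.
have sE : s%:C * s%:C = 1 + \det Y.
  by rewrite dE -rmorphM -expr2 sqr_sqrtr ?rmorphD // addr_ge0.
have Yt : (1%:M + Y) ^t* = 1%:M - Y.
  by rewrite trmxCD trmx1 map_mx1 (Yu : Y ^t* = - Y).
have YY : (1%:M + Y) *m (1%:M - Y) = (s%:C * s%:C)%:M.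
  rewrite mulmxDl !mulmxBr mul1mx mulmx1 mul1mx addrA subrK traceless_sqr //.
  by rewrite opprK -raddfD sE.
pose U := s%:C^-1 *: (1%:M + Y).
have Ut : U ^t* = s%:C^-1 *: (1%:M - Y).
  by rewrite trmxCZ Yt -fmorphV conj_real.
have UU : U \is unitarymx.
  apply/unitarymxP; rewrite Ut.
  rewrite -scalemxAl -scalemxAr scalerA YY scale_scalar_mx.
  by rewrite -invfM mulVf // mulf_neq0.
exists (s * s * c); first by rewrite !mulr_gt0.
exists (U *m g *m idiag nu *m invmx (U *m g)).
  by exists (U *m g); [apply: mul_unitarymx UU gU|reflexivity].
rewrite (invmx_unitary gU) (invmx_unitary (mul_unitarymx UU gU)) trmxCM Ut /U.
move: (1%:M + Y) (1%:M - Y) (idiag nu) (g ^t*) => P Q D gt.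
rewrite -!scalemxAr -!scalemxAl !scalerA !mulmxA.
congr (_ *: _); rewrite !rmorphM /=.
by move: c%:C s%:C sC => a b b0; field.
Qed.

Lemma cayley_expansion (u : C) X A :
  (1%:M + u *: X) *m A *m (1%:M - u *: X) =
  A + u *: (X *m A - A *m X) + u ^+ 2 *: - (X *m A *m X).
Proof.
rewrite mulmxDl mul1mx mulmxBr mulmx1 mulmxDl -!scalemxAl -!scalemxAr scalerA.
move: (X *m A) (A *m X) (X *m A *m X) => P Q S.
by apply/matrixP => i j; rewrite !mxE; move: (A i j) => a; ring.
Qed.

(** [W] splits into a radial part [s A] with the same trace and a traceless part [W0] orthogonal to
    [A]. The latter is a commutator of [A] with some [X] in u(2), and is the velocity of a Cayley
    curve. *)
Lemma tangent_coadj nu A W : nu 0 0 != nu 1 0 -> nu 0 0 + nu 1 0 != 0 ->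
  cone (coadj_orbit nu) A -> u2 R W ->
  \tr (W *m A) * \tr A = \tr (A *m A) * \tr W ->
  tangent (cone (coadj_orbit nu)) A W.
Proof.
move=> nu12 s0 OA Wu WA; have Au := coadj_cone_u2 OA.
have [c c0 [trA detA]] := coadj_cone_invariants OA.
have [w wE] := u2_mxtrace Wu.
pose s := w / (c * (nu 0 0 + nu 1 0)).
have sE : \tr W = s%:C * \tr A.
  rewrite wE trA mulrCA -rmorphM /s divfK // mulf_neq0 //.
  by rewrite gt_eqF.
pose W0 := W - s%:C *: A.
have W0u : u2 R W0 by apply: u2B => //; apply: u2Z.
have W00 : \tr W0 = 0 by rewrite raddfB /= mxtraceZ sE subrr.
have trA0 : \tr A != 0.
  rewrite trA mulf_neq0 ?neq0iC //; apply/eqP => /complexI /eqP.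
  by rewrite mulf_eq0 (negPf s0) gt_eqF.
have W0A : \tr (W0 *m A) = 0.
  apply: (mulIf trA0); rewrite mul0r mulmxBl raddfB /= -scalemxAl mxtraceZ.
  by rewrite mulrBl WA sE; move: (\tr (A *m A)) (\tr A) s%:C => *; ring.
(* The squared gap between the eigenvalues of [A], up to sign; it is the scalar of
   [double_commutator]. *)
pose D := c ^+ 2 * (nu 0 0 - nu 1 0) ^+ 2.
have D0 : 0 < D.
  by apply: mulr_gt0; [apply: exprn_gt0|rewrite exprn_even_gt0 //= subr_eq0].
have DE : 4 * \det A - \tr A ^+ 2 = D%:C.
  rewrite trA detA /D !rmorphM rmorphB rmorphD /=.
  move: (nu 0 0)%:C (nu 1 0)%:C c%:C => a b e.
  rewrite exprMn sqr_i; ring.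
pose X := D^-1%:C *: (A *m W0 - W0 *m A).
have Xu : u2 R X.
  apply: u2Z; rewrite /u2 /= trmxCB !trmxCM.
  rewrite (Au : A ^t* = - A) (W0u : W0 ^t* = - W0).
  by rewrite !mulmxN !mulNmx !opprK opprB.
have X0 : \tr X = 0.
  by rewrite mxtraceZ raddfB /= (mxtrace_mulC A) subrr mulr0.
have XA : X *m A - A *m X = W0.
  rewrite -scalemxAl -scalemxAr -scalerBr double_commutator // DE scalerA.
  by rewrite -rmorphM mulVf ?scale1r // gt_eqF.
have d0 : 0 < 1 + `|s| by rewrite ltr_pwDl.
have ht : \forall t \near (0 : R), `|t| < 1 / (1 + `|s|).
  by apply: nbhs0_lt; rewrite divr_gt0.
(* A polynomial substitute for conjugation by the exponential of [t X]: [cone_cayley] keeps it in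
   the cone, and the factor [1 + t * s] adds the radial velocity. *)
exists (fun t => (1 + t * s)%:C *:
  ((1%:M + t%:C *: X) *m A *m (1%:M - t%:C *: X))); split.
- by rewrite mul0r addr0 scale0r addr0 subr0 mul1mx mulmx1 scale1r.
- near=> t; apply: cone_scale.
    have : `|t| < 1 / (1 + `|s|) by near: t; exact: ht.
    rewrite ltr_pdivlMr // => h.
    rewrite -ltrBlDl sub0r; apply: lt_le_trans (_ : - `|t * s| <= _).
      rewrite ltrN2 normrM; apply: le_lt_trans h.
      by rewrite ler_wpM2l // lerDr.
    by rewrite lerNl -normrN ler_norm.
  apply: cone_cayley OA; first exact: u2Z.
  by rewrite mxtraceZ X0 mulr0.
- have E t : (1%:M + t%:C *: X) *m A *m (1%:M - t%:C *: X) =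
      A + t%:C *: (X *m A - A *m X) + (t ^+ 2)%:C *: - (X *m A *m X).
    by rewrite rmorphXn; apply: cayley_expansion.
  apply/velocityP => i j; have d1 := cder_poly2 (1 : C) s%:C 0.
  have d2 := cder_poly2 (A i j) (W0 i j) ((- (X *m A *m X)) i j).
  have -> : W i j = s%:C * (A i j + 0%:C * W0 i j +
      (0 ^+ 2)%:C * (- (X *m A *m X)) i j) +
      (1 + 0%:C * s%:C + (0 ^+ 2)%:C * 0) * W0 i j.
    have Wij : W i j = W0 i j + s%:C * A i j by rewrite !mxE subrK.
    by rewrite Wij expr0n /= !mul0r !addr0 mul1r addrC.
  apply: cder_ext (cderM d1 d2) => t.
  have ts : (1 + t * s)%:C = 1 + t%:C * s%:C :> C.
    by rewrite [LHS]rmorphD; congr (_ + _); apply: rmorphM.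
  by rewrite E XA coef_quadratic mulr0 addr0 ts.
Unshelve. all: by end_near. Qed.

End CoadjointTangent.

(** * Transversality away from the weights *)

Section Transversality.
Variable R : realType.
Local Notation C := R[i].
Variables (r : nat) (L : 'I_r -> int) (K : 'I_r -> nat).
Local Notation N := (\sum_(a < r) (K a).+1).
Local Notation V := 'cV[C]_N.
Local Notation Phi := (@Phi R r L K).
Local Notation Psi := (@Psi R r L K).
Implicit Types (nu : 'cV[R]_2) (m : Defs.proj R N) (A X Y xi : 'M[C]_2).

Opaque block_form moment_form dotT sqnorm.

Lemma moment_formula_u2 (Z : V) : u2 R (moment_formula L Z).
Proof.
rewrite /u2 /= moment_formulaE trmxCZ moment_formC sqnorm_real rmorphM /=.
by rewrite conjCi -fmorphV conj_real mulNr scaleNr.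
Qed.

Lemma Phi_u2 m : u2 R (Phi m).
Proof. exact: moment_formula_u2. Qed.

Lemma diag_part_t2 A : u2 R A -> t2 R (diag_part A).
Proof.
move=> /u2P Au; split; last exact: diag_mx_is_diag.
apply/u2P => i j; rewrite !mxE eq_sym; case: eqP => [->|_].
  by rewrite !mulr1n Au.
by rewrite !mulr0n rmorph0 oppr0.
Qed.

Lemma t2P A : t2 R A -> u2 R A /\ A = diag_part A.
Proof.
move=> [Au /is_diag_mxP Ad]; split=> //; apply/matrixP => i j; rewrite !mxE.
by case: eqP => [->|/eqP ij] //; rewrite Ad.
Qed.

Lemma diag_part_idiag nu : diag_part (idiag nu) = idiag nu.
Proof. by rewrite idiagE; apply: mx22P; rewrite !mxE. Qed.

Lemma diff_image_u2 m X : diff_image Phi m X -> u2 R X.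
Proof.
move=> [i [w [v [_ h]]]]; apply: velocity_u2 h.
by near=> t; apply: Phi_u2.
Unshelve. all: by end_near. Qed.

Lemma diff_imageZ m X (s : R) :
  diff_image Phi m X -> diff_image Phi m (s%:C *: X).
Proof.
move=> /diff_image_Phi [i [w [v [mE ->]]]]; apply/diff_image_Phi.
exists i, w, (s%:C *: v); split=> //; rewrite -dmomentZ; congr dmoment.
by apply/colP => k; rewrite !mxE; case: (unlift i k) => [j|] /=; rewrite ?mxE ?mulr0.
Qed.

Lemma diff_image_diag_part m X :
  diff_image Phi m X -> diff_image Psi m (diag_part X).
Proof.
move=> /diff_image_Phi [i [w [v [mE ->]]]]; apply/diff_image_Psi.
by exists i, w, v.
Qed.

Lemma diff_image_Psi_diag m X : diff_image Psi m X ->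
  exists2 X', diff_image Phi m X' & X = diag_part X'.
Proof.
move=> /diff_image_Psi [i [w [v [mE ->]]]].
exists (dmoment L (affine_pt i w) (pad i v)) => //; apply/diff_image_Phi.
by exists i, w, v.
Qed.

Lemma mxtrace_Phi m : definite L K ->
  exists2 t : R, \tr (Phi m) = 'i%C * t%:C &
    forall a, 0 < t * ((K a)%:Z + 2 * L a)%:~R.
Proof.
move=> def; have [i [w <-]] := chart_cover m; rewrite Phi_chart.
exact: definite_trace def (affine_pt_neq0 i w).
Qed.

(** The image of the differential either leaves the hyperplane orthogonal to [xi], or lies in it;
    then [critical_annihilator] and [annihilator_support] produce a weight relation. *)
Lemma direction_or_weight m xi : xi ^t* = xi -> \tr (Phi m *m xi) = 0 ->
  (exists2 X, diff_image Phi m X & \tr (X *m xi) != 0) \/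
  exists a (j : 'I_(K a).+1) (al : C),
    [/\ (al - xi 0 0) * (al - xi 1 1) = xi 0 1 * xi 1 0
      & ((K a - j)%:R + (L a)%:~R) * al +
        (j%:R + (L a)%:~R) * (xi 0 0 + xi 1 1 - al) = 0].
Proof.
move=> xiH; have [i [w mE]] := chart_cover m; rewrite -mE Phi_chart moment_formulaE.
rewrite -scalemxAl mxtraceZ => /eqP; rewrite mulf_eq0 mulf_eq0 invr_eq0.
rewrite (negPf (neq0iC R)) sqnorm_eq0 (negPf (affine_pt_neq0 i w)) /= => /eqP h0.
have [h|h] := pselect (forall v, \tr (dmoment L (affine_pt i w) (pad i v) *m xi) = 0).
  right; apply: (annihilator_support (affine_pt_neq0 i w)).
    by move=> x01; rewrite -xiH !mxE x01 rmorph0.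
  exact: critical_annihilator xiH h0 h.
left; have [v hv] : exists v, \tr (dmoment L (affine_pt i w) (pad i v) *m xi) <> 0.
  by apply: contrapT => hn; apply: h => v; apply: contrapT => hv; apply: hn; exists v.
exists (dmoment L (affine_pt i w) (pad i v)); last exact/eqP.
by apply/diff_image_Phi; exists i, w, v.
Qed.

Definition on_weight_ray nu := exists (a : 'I_r) (j : 'I_(K a).+1) (c : R),
  0 < c /\ nu = c *: nu_weight R (K a) j (L a).

Lemma nu_weight0 k (j : 'I_k.+1) l :
  nu_weight R k j l 0 0 = (k - j)%:R + l%:~R.
Proof. by rewrite mxE /= intrD intrB natrB // -ltnS ltn_ord. Qed.

Lemma nu_weight1 k j l : nu_weight R k j l 1 0 = j%:R + l%:~R.
Proof. by rewrite mxE /= intrD. Qed.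

(** The factor is the quotient of the coordinate sums of [nu] and of the weight; the sign hypothesis
    makes it positive. *)
Lemma proportional_weight nu a (j : 'I_(K a).+1) :
  0 < (nu 0 0 + nu 1 0) * ((K a)%:Z + 2 * L a)%:~R ->
  ((K a - j)%:R + (L a)%:~R) * nu 1 0 = (j%:R + (L a)%:~R) * nu 0 0 ->
  on_weight_ray nu.
Proof.
set s := nu 0 0 + _; set q := _%:~R => sq h.
have q0 : q != 0 by apply: contraTneq sq => ->; rewrite mulr0 ltxx.
have qE : q = ((K a - j)%:R + (L a)%:~R) + (j%:R + (L a)%:~R).
  rewrite /q intrD intrM natrB; last by rewrite -ltnS ltn_ord.
  by move: (L a)%:~R => x; rewrite -[(K a)%:~R]/((K a)%:R : R); ring.
clearbody q.
exists a, j, (s / q); split.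
  have -> : s / q = s * q * (q^-1 ^+ 2) by field.
  by rewrite mulr_gt0 // exprn_even_gt0 //= invr_eq0.
have nE x y : s * x = q * y -> y = s / q * x.
  by move=> e; apply: (mulfI q0); rewrite -e; field.
apply/colP => i; rewrite mxE; apply: nE.
have [->|->] : i = 0 \/ i = 1.
- by case: i => [[|[|//]] hi]; [left|right]; apply: val_inj.
- rewrite nu_weight0 /s qE; move: ((K a - j)%:R + _) (j%:R + _) h => x y h.
  transitivity (x * nu 0 0 + x * nu 1 0); first by ring.
  by rewrite h; ring.
- rewrite nu_weight1 /s qE; move: ((K a - j)%:R + _) (j%:R + _) h => x y h.
  transitivity (y * nu 0 0 + y * nu 1 0); first by ring.
  by rewrite -h; ring.
Qed.

Lemma natr_int_complex (k : nat) (l : int) :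
  (k%:R + l%:~R : C) = (k%:R + l%:~R)%:C.
Proof. by rewrite rmorphD /= rmorph_nat rmorph_int. Qed.

(** Serves both cones: the eigenvalues of [xi] are [u nu_2] and [- u nu_1], with sum [tau], and only
    the factor [u] differs. *)
Lemma weight_of_eigenvalue nu (u al tau : C) a (j : 'I_(K a).+1) : u != 0 ->
  0 < (nu 0 0 + nu 1 0) * ((K a)%:Z + 2 * L a)%:~R ->
  (al - u * (nu 1 0)%:C) * (al + u * (nu 0 0)%:C) = 0 ->
  tau = u * ((nu 1 0)%:C - (nu 0 0)%:C) ->
  ((K a - j)%:R + (L a)%:~R) * al + (j%:R + (L a)%:~R) * (tau - al) = 0 ->
  on_weight_ray nu.
Proof.
move=> u0 sq ev tauE e.
move: e; rewrite !natr_int_complex.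
have toR (x y : R) : u * (x%:C * (nu 1 0)%:C - y%:C * (nu 0 0)%:C) = 0 ->
    x * nu 1 0 = y * nu 0 0.
  move=> /eqP; rewrite mulf_eq0 (negPf u0) -!rmorphM subr_eq0 => /eqP.
  exact: complexI.
move/eqP: ev; rewrite mulf_eq0 subr_eq0 addr_eq0 => /orP [] /eqP alE e.
  apply: (proportional_weight sq (j := j)); apply: toR; rewrite -e tauE alE.
  by move: (_%:C) (_%:C) (nu 0 0)%:C (nu 1 0)%:C => *; ring.
(* The other eigenvalue swaps the coordinates of the weight, and so does reversing the index. *)
apply: (proportional_weight sq (j := rev_ord j)); apply: toR.
have kj : (K a - rev_ord j)%N = j by rewrite /= subSS subKn // -ltnS ltn_ord.
rewrite kj /= subSS -[RHS]e tauE alE.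
by move: (_%:C) (_%:C) (nu 0 0)%:C (nu 1 0)%:C => *; ring.
Qed.

(* Orthogonal to the ray of [idiag nu].                                       *)
Definition pairing_mx nu : 'M[C]_2 := mx22 (nu 1 0)%:C 0 0 (- (nu 0 0)%:C).

Lemma pairing_mx_herm nu : (pairing_mx nu) ^t* = pairing_mx nu.
Proof. by rewrite mx22C rmorphN rmorph0 /= !conj_real. Qed.

Lemma tr_pairing A nu :
  \tr (A *m pairing_mx nu) = A 0 0 * (nu 1 0)%:C - A 1 1 * (nu 0 0)%:C.
Proof. by rewrite mxtrace_mul2 !mxE /= !mulr0 addr0 add0r mulrN. Qed.

Lemma diag_partE A i : diag_part A i i = A i i.
Proof. by rewrite !mxE eqxx mulr1n. Qed.

Lemma tr_pairing_diag_part A nu :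
  \tr (diag_part A *m pairing_mx nu) = \tr (A *m pairing_mx nu).
Proof. by rewrite !tr_pairing !diag_partE. Qed.

Lemma diag_partD A B : diag_part (A + B) = diag_part A + diag_part B.
Proof. by apply/matrixP => i j; rewrite !mxE mulrnDl. Qed.

Lemma diag_partZ c A : diag_part (c *: A) = c *: diag_part A.
Proof. by apply/matrixP => i j; rewrite !mxE mulrnAr. Qed.

(** The trace at a point over the cone has the sign of [nu_1 + nu_2], and by definiteness that of
    every [K a + 2 L a]. *)
Lemma trace_sign nu (c : R) m : definite L K -> 0 < c ->
  \tr (Phi m) = 'i%C * (c * (nu 0 0 + nu 1 0))%:C ->
  forall a, 0 < (nu 0 0 + nu 1 0) * ((K a)%:Z + 2 * L a)%:~R.
Proof.
move=> def c0 trE a; have [t] := mxtrace_Phi m def; rewrite trE.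
move=> /(mulfI (neq0iC R)) /complexI <- /(_ a).
by rewrite -mulrA pmulr_rgt0.
Qed.

Lemma weight_sum_neq0 nu (a : 'I_r) :
  0 < (nu 0 0 + nu 1 0) * ((K a)%:Z + 2 * L a)%:~R -> nu 0 0 + nu 1 0 != 0.
Proof. by apply: contraTneq => ->; rewrite mul0r ltxx. Qed.

Lemma mxtrace_idiag nu (c : R) :
  \tr (c%:C *: idiag nu) = 'i%C * (c * (nu 0 0 + nu 1 0))%:C.
Proof.
rewrite mxtraceZ idiagE mxtrace2 !mxE /= rmorphM rmorphD /=.
by move: 'i%C c%:C (nu 0 0)%:C (nu 1 0)%:C => *; ring.
Qed.

Lemma tangent_ray_t2 nu A Y : tangent (cone [set idiag nu]) A Y -> t2 R Y.
Proof.
move=> [gamma [_ gS gY]].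
have near_cone : \forall t \near (0 : R), exists2 c : R, 0 < c & gamma t = c%:C *: idiag nu.
  by near=> t; apply: cone_idiag_tr; near: t.
have Yu : u2 R Y.
  apply: velocity_u2 gY; near=> t.
  have [c _ ->] : exists2 c : R, 0 < c & gamma t = c%:C *: idiag nu by near: t.
  exact/u2Z/idiag_u2.
suff -> : Y = diag_part Y by exact: diag_part_t2.
apply/matrixP => i j; apply: cder_uniq (gY i j) _.
apply: cder_near (velocity_diag_part gY i j); near=> t.
have [c _ ->] : exists2 c : R, 0 < c & gamma t = c%:C *: idiag nu by near: t.
by rewrite diag_partZ diag_part_idiag.
Unshelve. all: by end_near. Qed.

Lemma t2_pairing_eq0 W nu : t2 R W -> nu 0 0 + nu 1 0 != 0 ->
  \tr (W *m pairing_mx nu) = 0 -> exists s : R, W = s%:C *: idiag nu.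
Proof.
move=> /t2P [/u2P Wu WE] s0; rewrite tr_pairing => /eqP; rewrite subr_eq0.
have im i : W i i = 'i%C * (complex.Im (W i i))%:C.
  have := Wu i i; case: (W i i) => x y [xE]; apply/eqP; rewrite eq_complex /=.
  by apply/andP; split; apply/eqP; lra.
rewrite (im 0) (im 1); set w0 := complex.Im (W 0 0); set w1 := complex.Im (W 1 1).
rewrite -!mulrA -!rmorphM => /eqP /(mulfI (neq0iC R)) /complexI e.
exists ((w0 + w1) / (nu 0 0 + nu 1 0)).
have e0 : w0 = (w0 + w1) / (nu 0 0 + nu 1 0) * nu 0 0.
  apply: (mulIf s0); rewrite mulrAC divfK //; clearbody w0 w1.
  transitivity (w0 * nu 0 0 + w0 * nu 1 0); first by ring.
  by rewrite e; ring.
have e1 : w1 = (w0 + w1) / (nu 0 0 + nu 1 0) * nu 1 0.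
  apply: (mulIf s0); rewrite mulrAC divfK //; clearbody w0 w1.
  transitivity (w1 * nu 0 0 + w1 * nu 1 0); first by ring.
  by rewrite -e; ring.
move: (_ / _) e0 e1 => s e0 e1.
rewrite [LHS]WE idiagE; apply: mx22P; rewrite ?diag_partE !mxE /= ?mulr0 //.
  by rewrite (im 0) -/w0 e0 rmorphM mulrCA.
by rewrite (im 1) -/w1 e1 rmorphM mulrCA.
Qed.

(** Pairings of u(2) with Hermitian matrices are imaginary, so a real multiple of one image vector
    corrects any pairing. *)
Lemma real_quotient (x y : C) (x' y' : R) : x = 'i%C * x'%:C ->
  y = 'i%C * y'%:C -> x != 0 -> y = (y' / x')%:C * x.
Proof.
move=> -> -> h; have x'0 : x' != 0.
  by apply: contra_neq h => ->; rewrite mulr0.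
by rewrite mulrCA -rmorphM divfK.
Qed.

(** The tangent line of the ray is the kernel in [t2] of the pairing with [pairing_mx nu], so one
    image vector outside that kernel suffices. *)
Lemma Psi_transverse nu : definite L K -> ~ on_weight_ray nu ->
  transverse (t2 R) Psi (cone [set idiag nu]).
Proof.
move=> def nray m /cone_idiag_tr [c c0 PsiE].
have trE : \tr (Phi m) = 'i%C * (c * (nu 0 0 + nu 1 0))%:C.
  by rewrite -mxtrace_idiag -PsiE -[Psi m]/(diag_part (Phi m)) mxtrace_diag_part.
have sgn := trace_sign def c0 trE.
have P0 : \tr (Phi m *m pairing_mx nu) = 0.
  rewrite -tr_pairing_diag_part -[diag_part _]/(Psi m) PsiE tr_pairing idiagE !mxE /=.
  by move: 'i%C c%:C (nu 0 0)%:C (nu 1 0)%:C => *; ring.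
have [[X dX X0]|[a [j [al [ev e]]]]] := direction_or_weight (pairing_mx_herm nu) P0;
  last first.
  case: nray; apply: (weight_of_eigenvalue (u := 1) (oner_neq0 _) (sgn a) _ _ e).
    by move: ev; rewrite !mxE /= mul0r opprK !mul1r.
  by rewrite !mxE /= mul1r.
have [b _] := block_neq0 (proj_repr_neq0 m); have s0 := weight_sum_neq0 (sgn b).
apply/seteqP; split=> [_ [X1 /diff_image_Psi_diag [X2 dX2 ->] [Y tY <-]]|Y Yt].
  have [Yu ->] := t2P (tangent_ray_t2 tY).
  rewrite -diag_partD; apply: diag_part_t2; apply: u2D Yu.
  exact: diff_image_u2 dX2.
have [x xE] := u2_mxtrace_mul (diff_image_u2 dX) (pairing_mx_herm nu).
have [y yE] := u2_mxtrace_mul (proj1 Yt) (pairing_mx_herm nu).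
have q := real_quotient xE yE X0; set t := (y / x) in q.
pose W := Y - diag_part (t%:C *: X).
have Wt : t2 R W.
  have [Yu YE] := t2P Yt.
  rewrite /W YE -scaleN1r -diag_partZ -diag_partD scaleN1r.
  by apply: diag_part_t2; apply: u2B Yu _; apply/u2Z/(diff_image_u2 dX).
have W0 : \tr (W *m pairing_mx nu) = 0.
  rewrite mulmxBl raddfB /= tr_pairing_diag_part -scalemxAl mxtraceZ q.
  by rewrite subrr.
have [s WE] := t2_pairing_eq0 Wt s0 W0.
exists (diag_part (t%:C *: X)).
  by apply: diff_image_diag_part; apply: diff_imageZ.
exists W; last by rewrite addrC subrK.
by rewrite PsiE WE; apply: tangent_ray.
Qed.

Lemma tangent_coadj_u2 nu A Y : tangent (cone (coadj_orbit nu)) A Y -> u2 R Y.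
Proof.
move=> [gamma [_ gS gY]]; apply: velocity_u2 gY; near=> t.
by apply: (coadj_cone_u2 (nu := nu)); near: t.
Unshelve. all: by end_near. Qed.

(* Spans the orthogonal, for the trace pairing with Hermitian matrices, of    *)
(* the tangent space at [A] of the cone over the orbit.                       *)
Definition orbit_normal A : 'M[C]_2 := \tr A *: A - (\tr (A *m A))%:M.

Lemma orbit_normal_herm A : u2 R A -> (orbit_normal A) ^t* = orbit_normal A.
Proof.
move=> Au; have trJ B : \tr (B ^t*) = Num.conj (\tr B).
  by rewrite /mxtrace rmorph_sum; apply: eq_bigr => i _; rewrite !mxE.
have AJ : A ^t* = - A := Au.
have t1 : Num.conj (\tr A) = - \tr A by rewrite -trJ AJ raddfN.
have AA : Num.conj (\tr (A *m A)) = \tr (A *m A).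
  by rewrite -trJ trmxCM AJ mulmxN mulNmx opprK.
have scJ (d : C) : (d%:M : 'M[C]_2) ^t* = (Num.conj d)%:M.
  by rewrite tr_scalar_mx map_scalar_mx.
by rewrite trmxCB trmxCZ AJ t1 scJ AA scaleNr scalerN opprK.
Qed.

Lemma tr_orbit_normal W A :
  \tr (W *m orbit_normal A) = \tr (W *m A) * \tr A - \tr (A *m A) * \tr W.
Proof.
rewrite mulmxBr raddfB /= -scalemxAr mxtraceZ mul_mx_scalar mxtraceZ.
by rewrite (mulrC (\tr A)).
Qed.

Lemma orbit_normal_charpoly A :
  orbit_normal A 0 0 + orbit_normal A 1 1 = 4 * \det A - \tr A ^+ 2 /\
  orbit_normal A 0 0 * orbit_normal A 1 1 - orbit_normal A 0 1 * orbit_normal A 1 0 =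
  \det A * (4 * \det A - \tr A ^+ 2).
Proof.
rewrite !mxE /= det2 mxtrace_mul2 mxtrace2 ?mulr1n ?mulr0n.
by split; move: (A 0 0) (A 0 1) (A 1 0) (A 1 1) => *; ring.
Qed.

(** By [tangent_coadj] the kernel in u(2) of the pairing with [orbit_normal] is tangent to the cone,
    so again one image vector outside it suffices. *)
Lemma Phi_transverse nu : definite L K -> nu 0 0 != nu 1 0 ->
  ~ on_weight_ray nu -> transverse (u2 R) Phi (cone (coadj_orbit nu)).
Proof.
move=> def nu12 nray m OA; have Au := Phi_u2 m.
have [c c0 [trE detE]] := coadj_cone_invariants OA.
have sgn := trace_sign def c0 trE.
have [b _] := block_neq0 (proj_repr_neq0 m); have s0 := weight_sum_neq0 (sgn b).
set xi := orbit_normal (Phi m).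
have xiH : xi ^t* = xi by exact: orbit_normal_herm.
have P0 : \tr (Phi m *m xi) = 0 by rewrite tr_orbit_normal subrr.
have [[X dX X0]|[a [j [al [ev e]]]]] := direction_or_weight xiH P0; last first.
  have [trxi detxi] := orbit_normal_charpoly (Phi m).
  rewrite -/xi detE trE in trxi detxi.
  set n1 := (nu 0 0)%:C; set n2 := (nu 1 0)%:C.
  (* The trace of [xi] is [d ^+ 2] and its determinant is [- c ^+ 2 * n1 * n2 * d ^+ 2]; hence its
     eigenvalues are [- c * d * n2] and [c * d * n1]. *)
  pose d : C := c%:C * (n1 - n2).
  have d0 : d != 0.
    rewrite mulf_neq0 //; first by apply/eqP => /complexI /eqP; rewrite gt_eqF.
    by rewrite subr_eq0; apply/eqP => /complexI /eqP; rewrite (negPf nu12).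
  have tauE : 4 * - (c ^+ 2 * (nu 0 0 * nu 1 0))%:C -
      ('i%C * (c * (nu 0 0 + nu 1 0))%:C) ^+ 2 = d ^+ 2.
    rewrite exprMn sqr_i /d /n1 /n2 !rmorphM rmorphD /=.
    by move: (nu 0 0)%:C (nu 1 0)%:C c%:C => *; ring.
  rewrite tauE in trxi detxi.
  case: nray; apply: (weight_of_eigenvalue (u := - c%:C * d) _ (sgn a) _ _ e).
  - rewrite mulf_neq0 // oppr_eq0.
    by apply/eqP => /complexI /eqP; rewrite gt_eqF.
  - rewrite -/n1 -/n2.
    transitivity ((al - xi 0 0) * (al - xi 1 1) - xi 0 1 * xi 1 0); last first.
      by rewrite ev subrr.
    transitivity (al ^+ 2 - (xi 0 0 + xi 1 1) * al +
      (xi 0 0 * xi 1 1 - xi 0 1 * xi 1 0)); last first.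
      by move: (xi 0 0) (xi 0 1) (xi 1 0) (xi 1 1) => *; ring.
    rewrite trxi detxi /d /n1 /n2 !rmorphM /=.
    by move: (nu 0 0)%:C (nu 1 0)%:C c%:C => *; ring.
  - rewrite trxi /d /n1 /n2.
    by move: (nu 0 0)%:C (nu 1 0)%:C c%:C => *; ring.
apply/seteqP; split=> [_ [X1 dX1 [Y tY <-]]|Y Yu].
  by apply: u2D; [apply: diff_image_u2 dX1|apply: tangent_coadj_u2 tY].
have [x xE] := u2_mxtrace_mul (diff_image_u2 dX) xiH.
have [y yE] := u2_mxtrace_mul Yu xiH.
have q := real_quotient xE yE X0; set t := (y / x) in q.
pose W := Y - t%:C *: X.
have Wu : u2 R W by apply: u2B Yu _; apply/u2Z/(diff_image_u2 dX).
have W0 : \tr (W *m xi) = 0.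
  by rewrite mulmxBl raddfB /= -scalemxAl mxtraceZ q subrr.
exists (t%:C *: X); first exact: diff_imageZ.
exists W; last by rewrite addrC subrK.
apply: tangent_coadj => //; apply/eqP; rewrite -subr_eq0.
by rewrite -tr_orbit_normal -/xi W0.
Qed.

End Transversality.

(** * Weight vectors *)

Section WeightPoints.
Variable R : realType.
Local Notation C := R[i].
Variables (r : nat) (L : 'I_r -> int) (K : 'I_r -> nat).
Local Notation N := (\sum_(a < r) (K a).+1).
Local Notation V := 'cV[C]_N.
Local Notation Phi := (@Phi R r L K).
Local Notation Psi := (@Psi R r L K).
Implicit Types (nu : 'cV[R]_2) (m : Defs.proj R N) (A X Y xi : 'M[C]_2).

Opaque block_form moment_form dotT sqnorm.

(** The point is the class of a weight vector. A diagonal [xi] acts on it by pairing with the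
    weight, and for [pairing_mx nu] this scalar is zero. *)
Lemma weight_point nu : definite L K -> on_weight_ray L K nu ->
  exists m (c : R), [/\ 0 < c, Phi m = c%:C *: idiag nu &
    forall X, diff_image Phi m X -> \tr (X *m pairing_mx nu) = 0].
Proof.
move=> def [a [j [c [c0 nuE]]]].
pose v : 'cV[C]_(K a).+1 := delta_mx j 0.
have nu0 : nu 0 0 = c * ((K a - j)%:R + (L a)%:~R).
  by rewrite nuE mxE nu_weight0.
have nu1 : nu 1 0 = c * (j%:R + (L a)%:~R) by rewrite nuE mxE nu_weight1.
pose Z : V := inject_block v.
have Z0 : Z != 0.
  apply/eqP => /(congr1 (fun U : V => submxcol U a)).
  rewrite inject_blockK submxcol0 => /colP /(_ j) /eqP.
  by rewrite !mxE !eqxx oner_eq0.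
pose n := complex.Re (sqnorm Z).
have nE : sqnorm Z = n%:C by exact: sqnorm_real.
have n0 : 0 < n by rewrite -ltcR -nE lt_def sqnorm_eq0 Z0 sqnorm_ge0.
have PhiE : Phi (proj_class Z0) = ((n * c)^-1)%:C *: idiag nu.
  rewrite Phi_class moment_formulaE moment_form_injectl inject_blockK nE.
  rewrite block_form_delta ?eqxx ?scale1r; [|by rewrite gtn_eqF..].
  rewrite idiagE nu0 nu1 !natr_int_complex -!mx22Z !mulr0.
  have nC : n%:C != 0 :> C by apply/eqP => /complexI /eqP; rewrite gt_eqF.
  have cC : c%:C != 0 :> C by apply/eqP => /complexI /eqP; rewrite gt_eqF.
  rewrite fmorphV !rmorphM /=.
  move: n%:C c%:C nC cC (_ + _)%:C (_ + _)%:C => x y x0 y0 w0 w1.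
  by congr mx22; field; rewrite x0 y0.
have hZ W : \tr (moment_form L Z W *m pairing_mx nu) = 0.
  rewrite moment_form_injectl tr_block_form_diag ?mxE //=.
  rewrite nu0 nu1 !natr_int_complex !rmorphM /=.
  by move: (Num.conj _) c%:C (_ + _)%:C (_ + _)%:C => *; ring.
exists (proj_class Z0), (n * c)^-1; split=> //.
  by rewrite invr_gt0 mulr_gt0.
move=> X /diff_image_Phi [i [w [u [mE ->]]]].
(* A chart may represent the same point by another multiple of [Z]. *)
have [d dE] : exists d : C, affine_pt i w = d *: Z.
  have : line_of (chart i w) (affine_pt i w) by exists 1; rewrite scale1r.
  by rewrite mE => - [d ->]; exists d.
have hA W : \tr (moment_form L (affine_pt i w) W *m pairing_mx nu) = 0.
  by rewrite dE moment_formZl -scalemxAl mxtraceZ hZ mulr0.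
have hA' W : \tr (moment_form L W (affine_pt i w) *m pairing_mx nu) = 0.
  by rewrite -moment_formC (tr_conj _ (pairing_mx_herm nu)) (hA W) rmorph0.
apply: etrans (tr_dmoment (pad i u) (hA (affine_pt i w))) _.
apply: etrans (congr1 _ (congr2 +%R (hA (pad i u)) (hA' (pad i u)))) _.
by rewrite addr0 mulr0.
Qed.

Lemma pairing_witness nu : nu 0 0 != nu 1 0 -> exists2 E : 'M[C]_2,
  t2 R E & \tr (E *m pairing_mx nu) != 0.
Proof.
(* Turning [nu] by a right angle makes the pairing [i] times the squared length of [nu]. *)
move=> nu12; exists (idiag (\col_k (if k == 0 then nu 1 0 else - nu 0 0))).
  by rewrite -diag_part_idiag; apply/diag_part_t2/idiag_u2.
rewrite tr_pairing idiagE !mxE /=.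
have -> : 'i%C * (nu 1 0)%:C * (nu 1 0)%:C - 'i%C * (- nu 0 0)%:C * (nu 0 0)%:C =
  'i%C * (nu 1 0 ^+ 2 + nu 0 0 ^+ 2)%:C :> C.
  rewrite rmorphD !rmorphXn rmorphN /=.
  by move: 'i%C (nu 0 0)%:C (nu 1 0)%:C => *; ring.
rewrite mulf_neq0 ?neq0iC //; apply/eqP => /complexI /eqP.
rewrite paddr_eq0 ?sqr_ge0 // !sqrf_eq0 => /andP [/eqP e1 /eqP e0].
by rewrite e0 e1 eqxx in nu12.
Qed.

(** At the weight point the image and the tangent line both pair to zero with [pairing_mx nu], so
    their sum misses the witness. *)
Lemma Psi_not_transverse nu : definite L K -> nu 0 0 != nu 1 0 ->
  on_weight_ray L K nu -> ~ transverse (t2 R) Psi (cone [set idiag nu]).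
Proof.
move=> def nu12 /(weight_point def) [m [c [c0 PhiE crit]]].
have PsiE : Psi m = c%:C *: idiag nu.
  by rewrite -[Psi m]/(diag_part (Phi m)) PhiE diag_partZ diag_part_idiag.
have [E Et E0] := pairing_witness nu12.
move=> /(_ m) -/(_ (ex_intro2 _ _ c c0 (ex_intro2 _ _ (idiag nu) erefl PsiE))) T.
move: Et; rewrite -T => - [_ /diff_image_Psi_diag [X dX ->] [Y tY XY]].
case/eqP: E0; rewrite -XY mulmxDl mxtraceD tr_pairing_diag_part crit // add0r.
by rewrite tr_pairing (tangent_ray_inv tY) subrr.
Qed.

Lemma Phi_not_transverse nu : definite L K -> nu 0 0 != nu 1 0 ->
  on_weight_ray L K nu -> ~ transverse (u2 R) Phi (cone (coadj_orbit nu)).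
Proof.
move=> def nu12 ray; have [m [c [c0 PhiE crit]]] := weight_point def ray.
have [E [Eu _] E0] := pairing_witness nu12.
have trE : \tr (Phi m) = 'i%C * (c * (nu 0 0 + nu 1 0))%:C.
  by rewrite PhiE mxtrace_idiag.
have [b _] := ray; have s0 := weight_sum_neq0 (trace_sign def c0 trE b).
have OD : coadj_orbit nu (idiag nu).
  exists 1%:M; first by apply/unitarymxP; rewrite trmx1 map_mx1 mulmx1.
  by rewrite invmx1 mul1mx mulmx1.
move=> /(_ m) -/(_ (ex_intro2 _ _ c c0 (ex_intro2 _ _ (idiag nu) OD PhiE))) T.
move: Eu; rewrite -T => - [X dX [Y tY XY]].
case/eqP: E0; rewrite -XY mulmxDl mxtraceD crit // add0r tr_pairing.
(* The moment map is diagonal at the weight point, so tangent vectors of the whole cone also pair to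
   zero there. *)
move: tY; rewrite PhiE => /tangent_coadj_diag -> //; first by rewrite subrr.
by rewrite gt_eqF.
Qed.

End WeightPoints.

(** * Equivalence of both failures of transversality with the weight condition *)

Theorem theorem2p5 (R : realType) (r : nat) (L : 'I_r -> int) (K : 'I_r -> nat)
    (r_gt0 : (0 < r)%N) (gLK : generic L K) :
  [/\ definite L K <-> ~ range (@Phi R r L K) 0,
      definite L K <-> ~ range (@Psi R r L K) 0
    & definite L K ->
      forall nu : 'cV[R]_2, nu 0 0 != nu 1 0 ->
        (~ transverse (u2 R) (@Phi R r L K) (cone (coadj_orbit nu)) <->
         ~ transverse (t2 R) (@Psi R r L K) (cone [set idiag nu])) /\
        (~ transverse (t2 R) (@Psi R r L K) (cone [set idiag nu]) <->
         exists (a : 'I_r) (j : 'I_(K a).+1) (c : R),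
           0 < c /\ nu = c *: nu_weight R (K a) j (L a))].
Proof.
split; [exact: range_Phi0|exact: range_Psi0|move=> def nu nu12].
have PsiP : ~ transverse (t2 R) (@Psi R r L K) (cone [set idiag nu]) <->
    on_weight_ray L K nu.
  split=> [nt|]; last exact: Psi_not_transverse.
  by apply: contrapT => nray; apply: nt; exact: Psi_transverse.
have PhiP : ~ transverse (u2 R) (@Phi R r L K) (cone (coadj_orbit nu)) <->
    on_weight_ray L K nu.
  split=> [nt|]; last exact: Phi_not_transverse.
  by apply: contrapT => nray; apply: nt; exact: Phi_transverse.
by split; [apply: iff_trans PhiP (iff_sym PsiP)|].
Qed.
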